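(* Fix $n\ge1$. Let $f\in W$ and let $u_n\in W$ be the solution of the Neumann problem $$ \begin{aligned} f(x) ={}& \chi_{A_n}(x)\int_{A_n\cap\Omega} J(x,y)(u_n(y)-u_n(x))\,dy + \chi_{A_n}(x)\int_{B_n\cap\Omega} R(x,y)(u_n(y)-u_n(x))\,dy\\ &+\chi_{B_n}(x)\int_{A_n\cap\Omega} R(x,y)(u_n(y)-u_n(x))\,dy+\chi_{B_n}(x)\int_{B_n\cap\Omega} G(x,y)(u_n(y)-u_n(x))\,dy,\qquad x\in\overline\Omega . \end{aligned} $$ Then $$u_n(x)=-\int_0^\infty\mathbb{E}^x\big[f(Y_n(t))\big]\,dt,\qquad x\in\overline\Omega .$$
   Context: $\Omega\subset\mathbb{R}^N$ is a bounded domain (open, connected). The kernels $V=J,G,R$ are continuous non-negative functions on $\mathbb{R}^N\times\mathbb{R}^N$ with $V(x,x)>0$, $V(x,y)=V(y,x)$, and they satisfy the probabilistic normalization $\int_\Omega V(x,y)\,dy=1$ for all $x\in\overline\Omega$. $A_n,B_n$ are disjoint measurable sets with $A_n\cup B_n=\overline\Omega$; $\chi_E$ is the characteristic function of $E$. $W=\{u\in L^2(\Omega):\int_\Omega u\,dx=0\}$. Functions $f$ and $u_n$ are regarded as everywhere-defined measurable functions on $\overline\Omega$ whose restrictions to $\Omega$ lie in $W$, with the equation holding for every $x\in\overline\Omega$. $(Y_n(t))_{t\ge0}$ is the continuous-time pure jump Markov process on $\overline\Omega$ with (bounded) generator $$ \begin{aligned} L_n g(x)={}&\chi_{A_n}(x)\int_\Omega\chi_{A_n}(y)J(x,y)(g(y)-g(x))\,dy+\chi_{B_n}(x)\int_\Omega\chi_{B_n}(y)G(x,y)(g(y)-g(x))\,dy\\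 &+\chi_{A_n}(x)\int_\Omega\chi_{B_n}(y)R(x,y)(g(y)-g(x))\,dy+\chi_{B_n}(x)\int_\Omega\chi_{A_n}(y)R(x,y)(g(y)-g(x))\,dy , \end{aligned} $$ that is, jumps inside $A_n$ are governed by $J$, jumps inside $B_n$ by $G$, and jumps between $A_n$ and $B_n$ by $R$. $P^x$ denotes the law of the process started at $x$, $P^x(Y_n(0)=x)=1$, and $\mathbb{E}^x$ the corresponding expectation. *)

(* Defs.v *)
From HB Require Import structures.
From mathcomp Require Import all_boot all_order all_algebra.
From mathcomp Require Import all_classical all_reals all_analysis.
From mathcomp Require Import measurable_realfun.

Set Implicit Arguments.
Unset Strict Implicit.
Unset Printing Implicit Defensive.

Import Order.TTheory GRing.Theory Num.Theory.
Import numFieldNormedType.Exports.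

Local Open Scope classical_set_scope.
Local Open Scope ring_scope.

Lemma pushforward_sigma_additive d d' (T1 : measurableType d)
    (T2 : measurableType d') (R : realFieldType)
    (m : {measure set T1 -> \bar R}) (f : T1 -> T2) :
  measurable_fun setT f -> semi_sigma_additive (pushforward m f).
Proof.
move=> mf.
exact: (@measure_semi_sigma_additive _ _ _
  (measure_function_pushforward__canonical__measure_function_Measure m mf)).
Qed.

(* Lebesgue measure on N-tuples: iterated product of the one-dimensional one *)
Section tuple_measure.
Context (R : realType) (n : nat).
Notation RT := (measurableTypeR R).
Variable m : {measure set (n.-tuple RT) -> \bar R}.
Local Open Scope ereal_scope.

Definition cons_tuple (p : RT * n.-tuple RT) : n.+1.-tuple RT :=
  [the n.+1.-tuple RT of p.1 :: p.2].

Lemma measurable_cons_tuple : measurable_fun setT cons_tuple.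
Proof. exact: measurable_cons. Qed.

Definition cons_measure := pushforward (lebesgue_measure \x^ m) cons_tuple.

Let cons_measure0 : cons_measure set0 = 0.
Proof. by rewrite /cons_measure /pushforward preimage_set0 measure0. Qed.

Let cons_measure_ge0 A : 0 <= cons_measure A.
Proof. exact: (@measure_ge0 _ _ _ (lebesgue_measure \x^ m)). Qed.

Let cons_measure_sigma_additive : semi_sigma_additive cons_measure.
Proof.
apply: (@pushforward_sigma_additive _ _ _ _ _ (lebesgue_measure \x^ m)).
exact: measurable_cons_tuple.
Qed.

HB.instance Definition _ := isMeasure.Build _ _ _ cons_measure
  cons_measure0 cons_measure_ge0 cons_measure_sigma_additive.

End tuple_measure.

Fixpoint tuple_lebesgue (R : realType) (n : nat) :
    {measure set (n.-tuple (measurableTypeR R)) -> \bar R} :=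
  if n is n'.+1 then cons_measure (tuple_lebesgue R n')
  else \d_[tuple].

(* Lebesgue measure on the Borel sets of R^N *)
Section borel_lebesgue.
Context (R : realType) (N : nat).

Definition borelRn := g_sigma_algebraType (@open 'rV[R]_N).

Definition row_of_tuple (t : N.-tuple (measurableTypeR R)) : borelRn :=
  \row_i (tnth t i : R).

Let measurable_preimage_ball (x : 'rV[R]_N) (e : R) :
  0 < e -> measurable (row_of_tuple @^-1` ball x e).
Proof.
move=> e0; rewrite (_ : _ @^-1` _ = \bigcap_(i in [set: 'I_N])
    ((fun t : N.-tuple (measurableTypeR R) => tnth t i) @^-1` ball (x ord0 i) e)).
  apply: fin_bigcap_measurable => // i _; rewrite -[X in measurable X]setTI.
  have mb : measurable (ball (x ord0 i) e : set R).
    by apply: open_measurable; exact: ball_open.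
  exact: (measurable_tnth i measurableT mb).
apply/seteqP; split => t /=.
  by move=> [_ xt] i _; have := xt ord0 i; rewrite mxE.
by move=> xt; split=> // i j; rewrite ord1 mxE; exact: xt.
Qed.

Lemma measurable_row_of_tuple : measurable_fun setT row_of_tuple.
Proof.
apply: (@measurability _ _ _ borelRn _ _ (@open 'rV[R]_N)) => //= _ [U oU <-]; rewrite setTI.
pose q2r (q : 'rV[rat]_N * nat) : 'rV[R]_N := map_mx ratr q.1.
rewrite (_ : _ @^-1` _ = \bigcup_(q in
    [set q : 'rV[rat]_N * nat | ball (q2r q) q.2.+1%:R^-1 `<=` U])
    (row_of_tuple @^-1` ball (q2r q) q.2.+1%:R^-1)).
  rewrite bigcup_mkcond; apply: countable_bigcupT_measurable => [|q]; first exact: countableP.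
  by case: ifP => // _; apply: measurable_preimage_ball; rewrite invr_gt0.
apply/seteqP; split => [t Ut|t [q /= qU]]; last exact: qU.
have /nbhs_ballP[e /= e0 eU] : nbhs (row_of_tuple t : 'rV[R]_N) U.
  exact: open_nbhs_nbhs.
have [k ke] : exists k : nat, (k.+1%:R^-1 : R) < e / 2.
  exists (Num.truncn (e / 2)^-1).
  by rewrite invf_plt ?posrE ?divr_gt0// truncnS_gt.
have k0 : 0 < (k.+1%:R^-1 : R) by rewrite invr_gt0.
have /choice[q tq] (i : 'I_N) : exists q : rat,
    ball ((row_of_tuple t : 'rV[R]_N) ord0 i) k.+1%:R^-1 (ratr q).
  have [y [yb [q _ qy]]] := @dense_rat R _ (ex_intro _ _ (ballxx
    ((row_of_tuple t : 'rV[R]_N) ord0 i) k0)) (ball_open _ _).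
  by exists q; rewrite qy.
have tq' : ball (q2r (\row_i q i, k)) k.+1%:R^-1 (row_of_tuple t : 'rV[R]_N).
  split=> // i j; rewrite ord1 !mxE; apply: ball_sym.
  by have := tq j; rewrite mxE.
exists (\row_i q i, k) => //= y qy; apply: eU.
apply: (@le_ball _ _ _ (k.+1%:R^-1 + k.+1%:R^-1)).
  by rewrite [leRHS]splitr lerD// ltW.
exact: ball_triangle (ball_sym tq') qy.
Qed.

Definition borel_lebesgue : set borelRn -> \bar R :=
  pushforward (tuple_lebesgue R N) row_of_tuple.

Let borel_lebesgue0 : borel_lebesgue set0 = 0%E.
Proof. by rewrite /borel_lebesgue /pushforward preimage_set0 measure0. Qed.

Let borel_lebesgue_ge0 A : (0 <= borel_lebesgue A)%E.
Proof. exact: (@measure_ge0 _ _ _ (tuple_lebesgue R N)). Qed.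

Let borel_lebesgue_sigma_additive : semi_sigma_additive borel_lebesgue.
Proof.
apply: (@pushforward_sigma_additive _ _ _ _ _ (tuple_lebesgue R N)).
exact: measurable_row_of_tuple.
Qed.

HB.instance Definition _ := isMeasure.Build _ _ _ borel_lebesgue
  borel_lebesgue0 borel_lebesgue_ge0 borel_lebesgue_sigma_additive.

End borel_lebesgue.


(* R^N with its usual topology and the sigma-algebra of the Lebesgue measurable
   sets, i.e. the completion of the Borel sigma-algebra. *)
Definition Rn (R : realType) (N : nat) : Type := 'rV[R]_N.

Section Rn.
Context (R : realType) (N : nat).
Notation cara := (caratheodory_type (@borel_lebesgue R N)^*%mu).

HB.instance Definition _ := NormedModule.copy (Rn R N) 'rV[R]_N.
HB.instance Definition _ := isMeasurable.Build
  (caratheodory_display (@borel_lebesgue R N)^*%mu) (Rn R N)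
  (@measurable0 _ cara) (@measurableC _ cara) (@bigcupT_measurable _ cara).

Definition lebesgue : set (Rn R N) -> \bar R :=
  @completed_measure_extension _ _ _ (@borel_lebesgue R N).

HB.instance Definition _ := isMeasure.Build _ _ _ lebesgue
  (@measure0 _ _ _ (@completed_measure_extension _ _ _ (@borel_lebesgue R N)))
  (@measure_ge0 _ _ _ (@completed_measure_extension _ _ _ (@borel_lebesgue R N)))
  (@measure_semi_sigma_additive _ _ _
     (@completed_measure_extension _ _ _ (@borel_lebesgue R N))).

End Rn.
Arguments lebesgue {R N}.

Lemma open_measurable_Rn (R : realType) N (A : set (Rn R N)) : open A -> measurable A.
Proof.
move=> oA; apply: (@caratheodory_measurable_mu_ext _ _ _ (@borel_lebesgue R N)).
exact: sub_sigma_algebra.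
Qed.

Section lebesgue_box.
Context (R : realType).

Let tuple_box n (a b : 'I_n -> R) : (forall i, a i <= b i) ->
  measurable [set t : n.-tuple (measurableTypeR R) | forall i, a i <= tnth t i <= b i] /\
  tuple_lebesgue R n [set t | forall i, a i <= tnth t i <= b i]
  = (\prod_(i < n) (b i - a i))%:E.
Proof.
elim: n a b => [|n IH] a b ab.
  rewrite big_ord0; split; first by rewrite (_ : mkset _ = setT) //; apply/seteqP; split=> // t _ [].
  by rewrite /= diracE mem_set //= => -[].
have mb : measurable [set t : n.+1.-tuple (measurableTypeR R) | forall i, a i <= tnth t i <= b i].
  rewrite (_ : mkset _ = \bigcap_(i in [set: 'I_n.+1])
    ((fun t : n.+1.-tuple (measurableTypeR R) => tnth t i) @^-1` `[a i, b i])).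
    apply: fin_bigcap_measurable => // i _; rewrite -[X in measurable X]setTI.
    exact: (measurable_tnth i measurableT (measurable_itv `[a i, b i])).
  apply/seteqP; split => t /=.
    by move=> xt i _; rewrite /= in_itv /=; exact: xt.
  by move=> xt i; have := xt i I; rewrite /= in_itv.
split=> //.
have [m1 m2] := IH (a \o lift ord0) (b \o lift ord0) (fun i => ab _).
rewrite big_ord_recl /= EFinM -m2 /= /cons_measure /pushforward.
rewrite (_ : _ @^-1` _ = `[a ord0, b ord0] `*`
   [set t : n.-tuple (measurableTypeR R) | forall i, (a \o lift ord0) i <= tnth t i <= (b \o lift ord0) i]); last first.
  apply/seteqP; split => -[x t] /=.
    move=> h; split; first by rewrite /= in_itv; exact: (h ord0).
    by move=> i; have := h (lift ord0 i); rewrite tnthS.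
  rewrite in_itv /= => -[h0 h] i; case: (unliftP ord0 i) => [j ->|->] //.
  by rewrite tnthS; exact: h.
rewrite product_measure2E //=.
by rewrite lebesgue_measure_itv /= lte_fin; case: ltP => // h; congr (_ * _)%E;
  rewrite (@le_anti _ R (a ord0) (b ord0)) ?subrr // ab h.
Qed.

Lemma lebesgue_box N (a b : 'I_N -> R) : (forall i, a i <= b i) ->
  lebesgue [set x : Rn R N | forall i, a i <= (x : 'rV_N) ord0 i <= b i]
  = (\prod_(i < N) (b i - a i))%:E.
Proof.
move=> ab; have [m1 <-] := tuple_box ab.
rewrite /lebesgue /completed_measure_extension measurable_mu_extE //=.
  rewrite /borel_lebesgue /pushforward; congr (tuple_lebesgue _ _ _).
  by apply/seteqP; split => t /= h i; have := h i; rewrite mxE.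
rewrite -[X in measurable X]setCK; apply: measurableC.
apply: sub_sigma_algebra; apply/closed_openC.
rewrite (_ : mkset _ = \bigcap_(i in [set: 'I_N])
    ((fun x : 'rV[R]_N => x ord0 i) @^-1` `[a i, b i])).
  apply: closed_bigI => i _; apply: preimage_closed; last exact: itv_closed.
  by move=> x _; exact: coord_continuous.
apply/seteqP; split => t /=.
  by move=> xt i _; rewrite /= in_itv /=; exact: xt.
by move=> xt i; have := xt i I; rewrite /= in_itv.
Qed.

End lebesgue_box.

Section nonlocal.
Context (R : realType) (N : nat).
Notation Rn := (Rn R N).
Implicit Types (Omega A B : set Rn) (J G K V : Rn -> Rn -> R) (u g : Rn -> R).

Definition nonlocal_kernel Omega V :=
  [/\ continuous (fun z : Rn * Rn => V z.1 z.2),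
      forall x y, 0 <= V x y,
      forall x, 0 < V x x,
      forall x y, V x y = V y x &
      forall x, closure Omega x -> \int[lebesgue]_(y in Omega) V x y = 1].

(* W = {u in L^2(Omega) : int_Omega u = 0}; values outside Omega are free *)
Definition zero_mean_L2 Omega : set (Rn -> R) :=
  [set u | (u \_ Omega : Rn -> R) \in Lfun lebesgue 2%:E /\
           \int[lebesgue]_(y in Omega) u y = 0].

(* J acts inside A, G inside B and K between A and B *)
Definition neumann_operator Omega A B J G K u (x : Rn) : R :=
    \1_A x * \int[lebesgue]_(y in A `&` Omega) (J x y * (u y - u x))
  + \1_A x * \int[lebesgue]_(y in B `&` Omega) (K x y * (u y - u x))
  + \1_B x * \int[lebesgue]_(y in A `&` Omega) (K x y * (u y - u x))
  + \1_B x * \int[lebesgue]_(y in B `&` Omega) (G x y * (u y - u x)).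

Definition jump_generator Omega A B J G K g (x : Rn) : R :=
    \1_A x * \int[lebesgue]_(y in Omega) (\1_A y * J x y * (g y - g x))
  + \1_B x * \int[lebesgue]_(y in Omega) (\1_B y * G x y * (g y - g x))
  + \1_A x * \int[lebesgue]_(y in Omega) (\1_B y * K x y * (g y - g x))
  + \1_B x * \int[lebesgue]_(y in Omega) (\1_A y * K x y * (g y - g x)).

End nonlocal.

(* Time-homogeneous Markov processes in continuous time with state space a
   measurable subset E of S: [P x] is the law of the process started at x.
   The time index is a real number, only t >= 0 is meaningful, and [P x] is only
   meaningful for x in E. *)
Section markov_process.
Context (R : realType) (d : measure_display) (T : measurableType d).
Context (d' : measure_display) (S : measurableType d').
Variables (E : set S) (P : S -> probability T R) (Y : R -> T -> S).

Definition past (s : R) : set (set T) :=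
  <<s [set Gamma | exists r C, [/\ 0 <= r <= s, measurable C &
                                   Gamma = Y r @^-1` C]] >>.

Definition markov_process :=
  [/\ forall t : R, 0 <= t -> measurable_fun setT (Y t) /\ range (Y t) `<=` E,
      forall (t : R) C, 0 <= t -> measurable C ->
        measurable_fun E (fun x => P x (Y t @^-1` C)),
      forall x, E x -> P x (Y 0 @^-1` [set x]) = 1%E &
      forall x (s t : R) Gamma C, E x -> 0 <= s -> 0 <= t ->
        past s Gamma -> measurable C ->
        P x (Gamma `&` Y (s + t) @^-1` C) =
        (\int[P x]_(w in Gamma) P (Y s w) (Y t @^-1` C))%E].

(* almost every path is a right-continuous step function with finitely many
   jumps in every bounded time interval *)
Definition pure_jump :=
  forall x, E x -> {ae P x, forall w, exists tau : nat -> R,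
    [/\ tau 0%N = 0, forall k, tau k < tau k.+1, tau @ \oo --> +oo &
        forall k t, tau k <= t < tau k.+1 -> Y t w = Y (tau k) w]}.

(* L is the infinitesimal generator, with respect to the sup norm, of the
   transition semigroup on the bounded measurable functions on E; L being
   bounded, all these functions belong to its domain *)
Definition has_bounded_generator (L : (S -> R) -> S -> R) :=
  forall g : S -> R, measurable_fun E g -> [bounded g x | x in E] ->
    {uniform E, (fun t x => (fine ('E_(P x)[g \o Y t])%E - g x) / t) @ 0^'+
       --> L g}.

End markov_process.

(* Main.v *)
From HB Require Import structures.
Require Import Defs.
From mathcomp Require Import all_boot all_order all_algebra.
From mathcomp Require Import all_classical all_reals all_analysis.
From mathcomp Require Import measurable_realfun.
From mathcomp Require Import lra ring.

Import Order.TTheory GRing.Theory Num.Theory.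
Import numFieldNormedType.Exports.

Set Implicit Arguments.
Unset Strict Implicit.
Unset Printing Implicit Defensive.

Local Open Scope classical_set_scope.
Local Open Scope ring_scope.

(** Write [E] for the closure of [Omega], [nu] for the Lebesgue measure
    restricted to [Omega], [k] for the kernel that equals [J] on [A x A], [G] on
    [B x B], [K] between [A] and [B], and 0 off [E x E], and [L] for the bounded
    operator [L g x = \int k x y (g y - g x) nu(dy)]. Both the generator of the
    process and the operator of the Neumann problem are [L]. With
    [T_t g x = E^x g(Y_t)], the formula
    [u = - \int_0^oo T_t (L u) dt] is the fundamental theorem of calculus for
    [t |-> T_t u x], whose derivative is [T_t (L u) x], provided that [T_t u x]
    tends to 0. So everything rests on the exponential decay of [T_t g x] for
    functions [g] of mean 0, with a bound that does not involve the supremum of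
    [|g|], since [u] may be unbounded.

    The generator is given on bounded measurable functions. For these the Markov
    property shows that [T_t] is a semigroup, commutes with [L], and has
    derivative [T_t L = L T_t] ([is_derive_trans], [trans_jump_op]). Three
    consequences are read off a derivative: [T_1 g >= C Q g] for [g >= 0], where
    [Q] is the integral operator of kernel [k] and [C > 0]
    ([trans1_ge_kernel_op]); the law of [Y_t] is at most [delta_x + c t nu],
    where [c] bounds [k] ([trans_le_add], [ge0_integral_kappa_le]), which is
    what makes unbounded functions integrable; and, [k] being symmetric, [T_t]
    preserves the [nu]-integral ([bint_trans]).

    Since [k] is bounded below near the diagonal and [Omega] is connected, mass
    can be moved from anywhere to a fixed small ball [B] in a bounded time:
    [T_m g >= e \int g dnu] on [B] for every [g >= 0] ([doeblin_minorization],
    by a connectedness argument followed by a compactness argument). For [g] of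
    mean 0 the positive and the negative part then cancel partially on [B], so
    that [T_m] contracts the L1 norm by a factor less than 1
    ([trans_L1_contraction]), and [T_t] decays exponentially in L1
    ([trans_L1_decay]). For a fixed [x] the equation
    [d/dt T_t g x = Q (T_t g) x - h(x) T_t g x], where
    [h(x) = \int k x y nu(dy)] is positive, turns this into the exponential decay
    of [T_t g x], with a bound that depends on [g] only through [|g x|] and the
    L1 norm of [g] ([trans_pointwise_decay]).

    Finally [u] is truncated at height [n] and recentred to a bounded function
    [w_n] of mean 0. The fundamental theorem of calculus on [[0, n]] applied to
    [w_n] and a single dominated convergence in time, with an exponential as
    dominating function, give the integrability and the formula at once
    ([potential_formula]). *)

(** * Bounded measurable functions *)

Section bounded_measurable.
Context d (X : measurableType d) (R : realType).
Implicit Types (g h : X -> R) (mu : {measure set X -> \bar R}).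

Definition bfun g := measurable_fun setT g /\ exists M, forall x, `|g x| <= M.

Lemma bfun_cst (a : R) : bfun (fun=> a).
Proof. by split; [exact: measurable_cst|exists `|a|]. Qed.

Lemma bfunD g h : bfun g -> bfun h -> bfun (fun x => g x + h x).
Proof.
move=> [mg [M gM]] [mh [N hN]]; split; first exact: measurable_funD.
by exists (M + N) => x; rewrite (le_trans (ler_normD _ _))// lerD.
Qed.

Lemma bfunZ (a : R) g : bfun g -> bfun (fun x => a * g x).
Proof.
move=> [mg [M gM]]; split; first exact: measurable_funM.
by exists (`|a| * M) => x; rewrite normrM ler_wpM2l.
Qed.

Lemma bfunN g : bfun g -> bfun (fun x => - g x).
Proof. by move=> bg; under eq_fun do rewrite -mulN1r; exact: bfunZ. Qed.

Lemma bfunB g h : bfun g -> bfun h -> bfun (fun x => g x - h x).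
Proof. by move=> bg bh; apply: bfunD => //; exact: bfunN. Qed.

Lemma bfunM g h : bfun g -> bfun h -> bfun (fun x => g x * h x).
Proof.
move=> [mg [M gM]] [mh [N hN]]; split; first exact: measurable_funM.
by exists (M * N) => x; rewrite normrM ler_pM.
Qed.

Lemma bfun_norm g : bfun g -> bfun (fun x => `|g x|).
Proof.
move=> [mg [M gM]]; split; first exact: measurableT_comp.
by exists M => x; rewrite normr_id.
Qed.

Lemma bfun_indic (U : set X) : measurable U -> bfun \1_U.
Proof.
move=> mU; split; first exact: measurable_indic.
by exists 1 => x; rewrite indicE; case: (_ \in _); rewrite ?normr1 ?normr0.
Qed.

Lemma bfun_integrable mu g : (mu setT < +oo)%E -> bfun g ->
  mu.-integrable setT (EFin \o g).
Proof.
move=> mufin [mg [M gM]]; apply: measurable_bounded_integrable => //.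
exists M; split; first exact: num_real.
by move=> y My x _ /=; apply: le_trans (gM x) (ltW My).
Qed.

Section finite.
Variable mu : {measure set X -> \bar R}.
Hypothesis mufin : (mu setT < +oo)%E.

Lemma bint_ge0 g : (forall x, 0 <= g x) -> 0 <= \int[mu]_x g x.
Proof. by move=> g0; exact: Rintegral_ge0. Qed.

Lemma bintD g h : bfun g -> bfun h ->
  \int[mu]_x (g x + h x) = \int[mu]_x g x + \int[mu]_x h x.
Proof. by move=> bg bh; apply: RintegralD => //; exact: bfun_integrable. Qed.

Lemma bintB g h : bfun g -> bfun h ->
  \int[mu]_x (g x - h x) = \int[mu]_x g x - \int[mu]_x h x.
Proof. by move=> bg bh; apply: RintegralB => //; exact: bfun_integrable. Qed.

Lemma bintZ (a : R) g : bfun g -> \int[mu]_x (a * g x) = a * \int[mu]_x g x.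
Proof. by move=> bg; apply: RintegralZl => //; exact: bfun_integrable. Qed.

Lemma le_bint g h : bfun g -> bfun h -> (forall x, g x <= h x) ->
  \int[mu]_x g x <= \int[mu]_x h x.
Proof.
by move=> bg bh gh; apply: le_Rintegral => //; exact: bfun_integrable.
Qed.

Lemma le_norm_bint g : bfun g -> `|\int[mu]_x g x| <= \int[mu]_x `|g x|.
Proof.
by move=> bg; apply: le_normr_Rintegral => //; exact: bfun_integrable.
Qed.

Lemma bint_cst (a : R) : \int[mu]_x a = a * fine (mu setT).
Proof. exact: Rintegral_cst. Qed.

Lemma bint_le_cst g (a : R) : bfun g -> (forall x, g x <= a) ->
  \int[mu]_x g x <= a * fine (mu setT).
Proof. by move=> bg ga; rewrite -bint_cst le_bint//; exact: bfun_cst. Qed.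

Lemma norm_bint_le_cst g (a : R) : bfun g -> (forall x, `|g x| <= a) ->
  `|\int[mu]_x g x| <= a * fine (mu setT).
Proof.
move=> bg ga; apply: le_trans (le_norm_bint bg) _.
by apply: bint_le_cst => //; exact: bfun_norm.
Qed.

Lemma EFin_bint g : bfun g -> (\int[mu]_x g x)%:E = (\int[mu]_x (g x)%:E)%E.
Proof.
move=> bg; rewrite /Rintegral fineK//; apply: integrable_fin_num => //.
exact: bfun_integrable.
Qed.

End finite.
End bounded_measurable.

Section bounded_fubini.
Context d (X : measurableType d) (R : realType).
Variable nu : {finite_measure set X -> \bar R}.

Let nufin : (nu setT < +oo)%E.
Proof. by rewrite -ge0_fin_numE// fin_num_measure. Qed.

Lemma bfun_section (F : X * X -> R) x : bfun F -> bfun (fun y => F (x, y)).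
Proof.
move=> [mF [M FM]]; split; last by exists M.
exact: measurableT_comp mF (measurable_pair1 x).
Qed.

Lemma bfun_swap (F : X * X -> R) : bfun F -> bfun (fun z => F (z.2, z.1)).
Proof.
move=> [mF [M FM]]; split; last by exists M.
exact: (measurableT_comp mF (@measurable_swap _ _ _ _)).
Qed.

Lemma bfun_comp_fst (g : X -> R) : bfun g -> bfun (fun z : X * X => g z.1).
Proof.
move=> [mg [M gM]]; split; last by exists M.
exact: measurableT_comp.
Qed.

Lemma bfun_comp_snd (g : X -> R) : bfun g -> bfun (fun z : X * X => g z.2).
Proof.
move=> [mg [M gM]]; split; last by exists M.
exact: measurableT_comp.
Qed.

Lemma bfun_integrable_prod (F : X * X -> R) : bfun F ->
  (nu \x nu)%E.-integrable setT (EFin \o F).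
Proof.
move=> bF; apply: bfun_integrable => //=.
rewrite -setXTT product_measure1E//=.
by rewrite lte_mul_pinfty// fin_num_measure.
Qed.

Lemma bfun_bint (F : X * X -> R) : bfun F ->
  bfun (fun x => \int[nu]_y F (x, y)).
Proof.
move=> bF; split; last first.
  have [M FM] := bF.2; exists (M * fine (nu setT)) => x.
  by apply: norm_bint_le_cst => //; exact: bfun_section.
have := measurable_fubini_F (bfun_integrable_prod bF).
rewrite /fubini_F => mF.
exact: (measurableT_comp (fine_measurable measurableT) mF).
Qed.

Lemma bfubini (F : X * X -> R) : bfun F ->
  \int[nu]_x \int[nu]_y F (x, y) = \int[nu]_y \int[nu]_x F (x, y).
Proof.
move=> bF; apply: EFin_inj; rewrite EFin_bint//; last exact: bfun_bint.
rewrite EFin_bint//; last exact: (bfun_bint (bfun_swap bF)).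
rewrite (eq_integral (fun x => \int[nu]_y (F (x, y))%:E)%E); last first.
  by move=> x _; rewrite EFin_bint//; exact: bfun_section.
rewrite [LHS](Fubini (bfun_integrable_prod bF)) /=.
apply: eq_integral => y _; rewrite EFin_bint//.
exact: (bfun_section y (bfun_swap bF)).
Qed.

End bounded_fubini.

(** * Monotonicity from derivatives on the half-line *)

Section real_lemmas.
Context (R : realType).

Lemma le0_of_le_small (a C del : R) : 0 < del ->
  (forall h, 0 < h -> h < del -> a <= h * C) -> a <= 0.
Proof.
move=> del0 aC; rewrite leNgt; apply/negP => a0.
pose h := Num.min (del / 2) (a / (2 * (`|C| + 1))).
have C1 : 0 < `|C| + 1 by rewrite ltr_wpDl.
have h0 : 0 < h by rewrite lt_min !divr_gt0// mulr_gt0.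
have hdel : h < del by rewrite gt_min ltr_pdivrMr// ltr_pMr// ltr1n.
have := aC h h0 hdel; apply/negP; rewrite -ltNge.
have hC : h * C <= h * (`|C| + 1).
  by rewrite ler_pM2l// (le_trans (ler_norm C))// lerDl.
apply: (le_lt_trans hC); apply: (@le_lt_trans _ _ (a / 2)); last first.
  by rewrite ltr_pdivrMr// ltr_pMr// ltr1n.
rewrite -ler_pdivlMr//; rewrite /h invfM mulrA.
by rewrite ge_min lexx orbT.
Qed.

Lemma le0_derive_nonincreasing (v v' : R -> R) :
  (forall t : R, 0 < t -> is_derive t (1 : R) v (v' t)) ->
  v t @[t --> 0^'+] --> v 0 ->
  (forall t : R, 0 < t -> v' t <= 0) ->
  forall s t : R, 0 <= s -> s <= t -> v t <= v s.
Proof.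
move=> dv cv v'0 s t s0 st.
apply: (@ler0_derive1_nincry R v 0) => //.
- by move=> x; rewrite in_itv/= andbT => x0; have [] := dv x x0.
- move=> x; rewrite in_itv/= andbT => x0; rewrite derive1E.
  by have [_ ->] := dv x x0; exact: v'0.
- apply: derivable_oy_Rcontinuous_within_itvcy; split => //.
  by move=> x; rewrite in_itv/= andbT => x0; have [] := dv x x0.
Qed.

Lemma is_derive_expRM (a t : R) :
  is_derive t (1 : R) (fun s => expR (a * s)) (a * expR (a * t)).
Proof.
have d1 : is_derive t (1 : R) (fun s : R => a * s) a.
  by apply: is_derive_eq; rewrite [LHS]mulr1.
have := @is_derive1_comp R expR (fun s => a * s) t _ _ (is_derive_expR _) d1.
by rewrite mulrC.
Qed.

Lemma continuous_expRM (a : R) : continuous (fun s => expR (a * s)).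
Proof.
move=> t; apply: continuous_comp; last exact: continuous_expR.
by apply: cvgM; [exact: cvg_cst|exact: cvg_id].
Qed.

Lemma is_derive_MexpR (a : R) (v : R -> R) (v' t : R) :
  is_derive t (1 : R) v v' ->
  is_derive t (1 : R) (fun s => expR (a * s) * v s)
    (expR (a * t) * (v' + a * v t)).
Proof.
move=> dv.
have := @is_deriveM R R^o (fun s => expR (a * s)) v t 1 _ _
  (is_derive_expRM a t) dv.
suff -> : expR (a * t) * (v' + a * v t) =
  (expR (a * t) *: v' + v t *: (a * expR (a * t)))%R by [].
by rewrite /GRing.scale /=; ring.
Qed.

Lemma ge0_derive_nondecreasing (v v' : R -> R) :
  (forall t : R, 0 < t -> is_derive t (1 : R) v (v' t)) ->
  v t @[t --> 0^'+] --> v 0 ->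
  (forall t : R, 0 < t -> 0 <= v' t) ->
  forall s t : R, 0 <= s -> s <= t -> v s <= v t.
Proof.
move=> dv cv v'0 s t s0 st.
apply: (@ger0_derive1_ndecry R v 0) => //.
- by move=> x; rewrite in_itv/= andbT => x0; have [] := dv x x0.
- move=> x; rewrite in_itv/= andbT => x0; rewrite derive1E.
  by have [_ ->] := dv x x0; exact: v'0.
- apply: derivable_oy_Rcontinuous_within_itvcy; split => //.
  by move=> x; rewrite in_itv/= andbT => x0; have [] := dv x x0.
Qed.

Lemma is_derive_Bline (v : R -> R) (v' C t : R) : is_derive t (1 : R) v v' ->
  is_derive t (1 : R) (fun s => v s - s * C) (v' - C).
Proof.
move=> dv; have dl : is_derive t (1 : R) (fun s : R => s * C) C.
  have -> : (fun s : R => s * C) = (fun s => C * s).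
    by apply/funext => s; rewrite mulrC.
  by apply: is_derive_eq; rewrite [LHS]mulr1.
exact: (is_deriveB dv dl).
Qed.

(** Only increments to the right are controlled, but uniformly in the starting
    point, so that they can be summed along a subdivision of [[0, t]]. *)
Lemma constant_of_small_increments (phi : R -> R) :
  (forall e : R, 0 < e -> exists2 del : R, 0 < del &
    forall t h : R, 0 <= t -> 0 < h -> h < del ->
      `|phi (t + h) - phi t| <= h * e) ->
  forall t : R, 0 <= t -> phi t = phi 0.
Proof.
move=> H t; rewrite le_eqVlt => /predU1P[<-//|t0].
apply/eqP; rewrite -subr_eq0 -normr_le0.
apply: (@le0_of_le_small _ t 1) => // e e0 _.
have [del del0 Hdel] := H e e0.
pose n := (Num.truncn (t / del)).+1.
have n0 : 0 < n%:R :> R by rewrite ltr0n.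
pose h := t / n%:R.
have h0 : 0 < h by rewrite divr_gt0.
have hd : h < del.
  by rewrite ltr_pdivrMr// mulrC -ltr_pdivrMr// truncnS_gt.
have step (i : nat) : `|phi (i%:R * h) - phi 0| <= i%:R * h * e.
  elim: i => [|i IH]; first by rewrite !mul0r subrr normr0.
  have := Hdel (i%:R * h) h.
  rewrite mulr_ge0 ?ler0n ?(ltW h0)// => /(_ isT h0 hd).
  have -> : i.+1%:R * h = i%:R * h + h by rewrite -natr1; ring.
  move: IH; set a := phi (i%:R * h); set b := phi (_ + h) => IH A.
  have -> : b - phi 0 = (b - a) + (a - phi 0) by ring.
  by apply: (le_trans (ler_normD _ _)); lra.
have := step n; have -> : n%:R * h = t by rewrite mulrC divfK ?gt_eqF.
by rewrite mulrC.
Qed.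

End real_lemmas.

(** * Dominated convergence and truncation *)

Section dominated.
Context d (X : measurableType d) (R : realType).
Variable mu : {measure set X -> \bar R}.

Lemma Rdominated_cvg (f_ : (X -> R)^nat) (f g : X -> R) :
  (forall n, measurable_fun setT (f_ n)) ->
  (forall x, f_ n x @[n --> \oo] --> f x) ->
  mu.-integrable setT (EFin \o g) ->
  (forall n x, `|f_ n x| <= g x) ->
  mu.-integrable setT (EFin \o f) /\
  \int[mu]_x f_ n x @[n --> \oo] --> \int[mu]_x f x.
Proof.
move=> mf_ f_f ig f_g.
have mf : measurable_fun setT f.
  by apply: (measurable_fun_cvg mf_) => x _; exact: f_f.
have [||||intf _ cf] := @dominated_convergence _ _ _ mu setT measurableT
  (fun n => EFin \o f_ n) (EFin \o f) (EFin \o g) _ _ _ ig.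
- by move=> n; exact/measurable_EFinP.
- exact/measurable_EFinP.
- by apply: aeW => x _; apply: cvg_EFin; [exact: nearW|exact: f_f].
- by apply: aeW => x n _ /=; rewrite lee_fin.
split=> //; apply: fine_cvg; rewrite /Rintegral fineK//.
exact: integrable_fin_num.
Qed.

Definition truncate (u : X -> R) (n : nat) x : R :=
  if `|u x| <= n%:R then u x else 0.

Lemma bfun_truncate u n : measurable_fun setT u -> bfun (truncate u n).
Proof.
move=> mu_; split; last first.
  by exists n%:R => x; rewrite /truncate; case: ifPn => // _; rewrite normr0.
apply: measurable_fun_ifT => //.
by apply: measurable_fun_ler => //; exact: measurableT_comp.
Qed.

Lemma truncate_le u n x : `|truncate u n x| <= `|u x|.
Proof. by rewrite /truncate; case: ifP => //; rewrite normr0. Qed.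

Lemma cvg_truncate u x : truncate u n x @[n --> \oo] --> u x.
Proof.
apply: cvg_near_cst; exists (Num.truncn `|u x|).+1 => // n /= un.
rewrite /truncate ifT// ltW// (lt_le_trans (truncnS_gt _))// ler_nat//.
Qed.

End dominated.

(** * The semigroup of a jump process with a bounded symmetric kernel *)

Section jump_operators.
Context d (X : measurableType d) (R : realType).
Variables (nu : {measure set X -> \bar R}) (k : X -> X -> R).
Variable kappa : R -> R.-pker X ~> X.

Definition kernel_op (g : X -> R) x := \int[nu]_y (k x y * g y).
Definition kernel_degree x := \int[nu]_y k x y.
Definition jump_op (g : X -> R) x := \int[nu]_y (k x y * (g y - g x)).
Definition trans t (g : X -> R) x := \int[kappa t x]_y g y.

(** The transition kernels [kappa t] of a Markov process whose generator is
    [jump_op], the limit being uniform in [x]. That [kappa 0] is the identity and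
    that the semigroup is continuous in [t] follow ([trans0],
    [trans_right_continuous]). *)
Record jump_semigroup (c : R) : Prop := JumpSemigroup {
  jump_measurable : measurable_fun setT (fun z : X * X => k z.1 z.2) ;
  jump_ge0 : forall x y, 0 <= k x y ;
  jump_le : forall x y, k x y <= c ;
  jump_sym : forall x y, k x y = k y x ;
  chapman_kolmogorov : forall (s t : R) x C, 0 <= s -> 0 <= t -> measurable C ->
    kappa (s + t) x C = (\int[kappa s x]_y kappa t y C)%E ;
  jump_generator_limit : forall g, bfun g -> forall e : R, 0 < e ->
    exists2 del : R, 0 < del & forall (h : R) x, 0 < h -> h < del ->
      `|trans h g x - g x - h * jump_op g x| <= h * e }.

End jump_operators.

Section jump_semigroup.
Context d (X : measurableType d) (R : realType).
Variables (nu : {finite_measure set X -> \bar R}) (k : X -> X -> R) (c : R).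
Variable kappa : R -> R.-pker X ~> X.
Hypothesis JS : jump_semigroup nu k kappa c.

Local Notation Q := (kernel_op nu k).
Local Notation L := (jump_op nu k).
Local Notation T := (trans kappa).
Local Notation H := (c * fine (nu setT)).

Let mk := jump_measurable JS.
Let k_ge0 := jump_ge0 JS.
Let k_le := jump_le JS.
Let k_sym := jump_sym JS.
Let kappaD := chapman_kolmogorov JS.
Let trans_generator := jump_generator_limit JS.

Let nufin : (nu setT < +oo)%E.
Proof. by rewrite -ge0_fin_numE// fin_num_measure. Qed.

Let bk : bfun (fun z : X * X => k z.1 z.2).
Proof. by split => //; exists c => z; rewrite ger0_norm. Qed.

Let bkx x : bfun (k x).
Proof. exact: (bfun_section x bk). Qed.

Lemma bfun_kernel_section g x : bfun g -> bfun (fun y => k x y * g y).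
Proof. exact: bfunM. Qed.

Lemma bfun_kernel_op g : bfun g -> bfun (Q g).
Proof.
move=> bg; apply: (bfun_bint nu (F := fun z => k z.1 z.2 * g z.2)).
by apply: bfunM => //; exact: bfun_comp_snd.
Qed.

Lemma bfun_degree : bfun (kernel_degree nu k).
Proof. exact: (bfun_bint nu bk). Qed.

Lemma jump_opE g x : bfun g -> L g x = Q g x - kernel_degree nu k x * g x.
Proof.
move=> bg; rewrite /jump_op /kernel_op /kernel_degree mulrC -bintZ// -bintB//.
- by apply: eq_Rintegral => y _; ring.
- exact: bfunM.
- exact: bfunZ.
Qed.

Lemma bfun_jump_op g : bfun g -> bfun (L g).
Proof.
move=> bg.
rewrite (_ : L g = fun x => Q g x - kernel_degree nu k x * g x); last first.
  by apply/funext => x; exact: jump_opE.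
by apply: bfunB; [exact: bfun_kernel_op|apply: bfunM => //; exact: bfun_degree].
Qed.

Lemma degree_ge0 x : 0 <= kernel_degree nu k x.
Proof. exact: bint_ge0. Qed.

Lemma degree_le x : kernel_degree nu k x <= H.
Proof. exact: bint_le_cst. Qed.

Lemma kernel_op_ge0 g x : (forall y, 0 <= g y) -> 0 <= Q g x.
Proof. by move=> g0; apply: bint_ge0 => y; rewrite mulr_ge0. Qed.

Lemma kernel_op_le g x : bfun g -> (forall y, 0 <= g y) ->
  Q g x <= c * \int[nu]_y g y.
Proof.
move=> bg g0; rewrite -bintZ//; apply: le_bint => //; first exact: bfunM.
  exact: bfunZ.
by move=> y; rewrite ler_wpM2r.
Qed.

Lemma norm_kernel_op_le g x : bfun g ->
  `|Q g x| <= c * \int[nu]_y `|g y|.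
Proof.
move=> bg; apply: (@le_trans _ _ (Q (fun y => `|g y|) x)); last first.
  by apply: kernel_op_le => //; exact: bfun_norm.
apply: (le_trans (le_norm_bint nufin (bfunM (bkx x) bg))).
rewrite /kernel_op.
under eq_Rintegral do rewrite normrM (ger0_norm (k_ge0 _ _)).
exact: lexx.
Qed.

(** Exchanging the two variables of the double integral changes its sign, [k]
    being symmetric. *)
Lemma jump_op_mean0 g : bfun g -> \int[nu]_x L g x = 0.
Proof.
move=> bg.
have bF : bfun (fun z : X * X => k z.1 z.2 * (g z.2 - g z.1)).
  apply: bfunM => //; apply: bfunB; first exact: bfun_comp_snd.
  exact: bfun_comp_fst.
have bLg := bfun_jump_op bg.
suff : \int[nu]_x L g x = - \int[nu]_x L g x.
  by move=> /eqP; rewrite -addr_eq0 -mulr2n mulrn_eq0/= => /eqP.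
rewrite [LHS](bfubini nu bF)/= -[RHS]mulN1r -bintZ//.
apply: eq_Rintegral => y _; rewrite /jump_op -bintZ//; last first.
  exact: (bfun_section y bF).
by apply: eq_Rintegral => x _; rewrite k_sym; ring.
Qed.

Let kfin t x : (kappa t x setT < +oo)%E.
Proof. by rewrite prob_kernel ltry. Qed.

Let kone t x : fine (kappa t x setT) = 1.
Proof. by rewrite prob_kernel. Qed.

Lemma transD t g h x : bfun g -> bfun h ->
  T t (fun y => g y + h y) x = T t g x + T t h x.
Proof. exact: bintD. Qed.

Lemma transB t g h x : bfun g -> bfun h ->
  T t (fun y => g y - h y) x = T t g x - T t h x.
Proof. exact: bintB. Qed.

Lemma transZ t a g x : bfun g -> T t (fun y => a * g y) x = a * T t g x.
Proof. exact: bintZ. Qed.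

Lemma trans_cst t a x : T t (fun=> a) x = a.
Proof. by rewrite /trans bint_cst kone mulr1. Qed.

Lemma trans_ge0 t g x : (forall y, 0 <= g y) -> 0 <= T t g x.
Proof. exact: bint_ge0. Qed.

Lemma le_trans_op t g h x : bfun g -> bfun h -> (forall y, g y <= h y) ->
  T t g x <= T t h x.
Proof. exact: le_bint. Qed.

Lemma norm_trans_le_cst t g a x : bfun g -> (forall y, `|g y| <= a) ->
  `|T t g x| <= a.
Proof.
by move=> bg ga; rewrite -[leRHS]mulr1 -(kone t x) norm_bint_le_cst.
Qed.

Lemma norm_trans_le t g x : bfun g -> `|T t g x| <= T t (fun y => `|g y|) x.
Proof. exact: le_norm_bint. Qed.

Lemma bfun_trans t g : bfun g -> bfun (T t g).
Proof.
move=> bg; have [mg [M gM]] := bg; split; last first.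
  by exists M => x; exact: norm_trans_le_cst.
have bgM : bfun (fun y => g y + M) by apply: bfunD => //; exact: bfun_cst.
have -> : T t g = fun x => T t (fun y => g y + M) x - M.
  by apply/funext => x; rewrite transD// ?trans_cst ?addrK//; exact: bfun_cst.
apply: measurable_funB => //.
apply: (measurableT_comp (fine_measurable measurableT)).
apply: measurable_fun_integral_kernel.
- by move=> U mU; exact: measurable_kernel.
- move=> z; rewrite lee_fin.
  by have := gM z; rewrite ler_norml => /andP[+ _]; lra.
- by apply/measurable_EFinP; exact: bgM.1.
Qed.

Lemma ge0_integral_kappaD s t x (g : X -> \bar R) : 0 <= s -> 0 <= t ->
  measurable_fun setT g -> (forall y, 0 <= g y)%E ->
  (\int[kappa (s + t) x]_z g z =
   \int[kappa s x]_y \int[kappa t y]_z g z)%E.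
Proof.
move=> s0 t0 mg g0.
have <- := integral_kcomp (kappa s) (kernel.kernel_snd (kappa t)) x g0 mg.
by apply: eq_measure_integral => C mC _; exact: kappaD.
Qed.

Lemma trans_semigroup s t g x : 0 <= s -> 0 <= t -> bfun g ->
  T (s + t) g x = T s (T t g) x.
Proof.
move=> s0 t0 bg; have [mg [M gM]] := bg.
have bM : bfun (fun=> M : R) := bfun_cst X M.
have bgM : bfun (fun y => g y + M) by exact: bfunD.
suff : T (s + t) (fun y => g y + M) x = T s (T t (fun y => g y + M)) x.
  rewrite (transD (s + t) x bg bM) trans_cst.
  have -> : T t (fun y => g y + M) = fun y => T t g y + M.
    by apply/funext => y; rewrite transD// trans_cst.
  rewrite transD ?trans_cst//; last exact: bfun_trans.
  by move/addIr.
apply: EFin_inj; rewrite EFin_bint//.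
rewrite EFin_bint//; last exact: bfun_trans.
rewrite ge0_integral_kappaD//.
- by apply: eq_integral => y _; rewrite EFin_bint.
- by apply/measurable_EFinP; exact: bgM.1.
- move=> z; rewrite lee_fin.
  by have := gM z; rewrite ler_norml => /andP[+ _]; lra.
Qed.

(** For small [h], [T_h g = T_h (T_0 g)] is close to both [g] and [T_0 g]. *)
Lemma trans0 g x : bfun g -> T 0 g x = g x.
Proof.
move=> bg; have bg0 := bfun_trans 0 bg.
have [d1 d10 H1] := trans_generator bg ltr01.
have [d2 d20 H2] := trans_generator bg0 ltr01.
apply/eqP; rewrite -subr_eq0 -normr_le0.
apply: (@le0_of_le_small _ _ (1 + `|L g x| + (1 + `|L (T 0 g) x|))
  (Num.min d1 d2)).
  by rewrite lt_min d10.
move=> h h0; rewrite lt_min => /andP[hd1 hd2].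
have := H1 h x h0 hd1; have := H2 h x h0 hd2.
have -> : T h (T 0 g) x = T h g x by rewrite -trans_semigroup// ?addr0// ltW.
set a := T h g x; set b := T 0 g x; set l := L _ x; set l' := L _ x => A B.
have E : b - g x =
  (a - g x - h * l') - (a - b - h * l) + (h * l' - h * l) by ring.
rewrite E; apply: (le_trans (ler_normD _ _)).
apply: (le_trans (lerD (ler_normB _ _) (ler_normB _ _))).
rewrite !normrM (gtr0_norm h0); nra.
Qed.

(** [T_(t + h) g - T_t g - h T_t (L g)] is the image under the contraction [T_t]
    of the same expression at [t = 0], so that the generator controls the
    increments uniformly in [t]. *)
Lemma trans_increment g : bfun g -> forall e : R, 0 < e ->
  exists2 del : R, 0 < del & forall (t h : R) x, 0 <= t -> 0 < h -> h < del ->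
    `|T (t + h) g x - T t g x - h * T t (L g) x| <= h * e.
Proof.
move=> bg e e0; have [del del0 Hdel] := trans_generator bg e0.
exists del => // t h x t0 h0 hdel.
have bLg := bfun_jump_op bg; have bTg := bfun_trans h bg.
have bhL := bfunZ h bLg.
rewrite trans_semigroup//; last exact: ltW.
rewrite -transB// -transZ// -transB//; last exact: bfunB.
apply: norm_trans_le_cst; first by do 2 apply: bfunB => //.
by move=> y; exact: Hdel.
Qed.

(** Both sides are the right derivative at [t] of [T_t g x], according to
    whether [T_(t + h)] is read as [T_t T_h] or as [T_h T_t]. *)
Lemma trans_jump_op t g x : 0 <= t -> bfun g -> T t (L g) x = L (T t g) x.
Proof.
move=> t0 bg; apply/eqP; rewrite -subr_eq0 -normr_le0.
apply: (@le0_of_le_small _ _ 2 1) => // e e0 _.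
have [d1 d10 H1] := trans_increment bg e0.
have [d2 d20 H2] := trans_generator (bfun_trans t bg) e0.
pose h := Num.min d1 d2 / 2.
have h0 : 0 < h by rewrite divr_gt0// lt_min d10.
have : h < Num.min d1 d2 by rewrite ltr_pdivrMr// ltr_pMr ?ltr1n// lt_min d10.
rewrite lt_min => /andP[hd1 hd2].
have := H1 t h x t0 h0 hd1; have := H2 h x h0 hd2.
rewrite -trans_semigroup//; last exact: ltW.
rewrite (addrC h t).
set a := T _ g x; set b := T t g x; set l := T t _ x; set l' := L _ x => A B.
rewrite -(ler_pM2l h0) -{1}(gtr0_norm h0) -normrM.
have -> : h * (l - l') = (a - b - h * l') - (a - b - h * l) by ring.
by apply: (le_trans (ler_normB _ _)); lra.
Qed.

Lemma trans_lipschitz g : bfun g -> exists2 C : R, 0 < C &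
  exists2 del : R, 0 < del & forall (t h : R) x, 0 <= t -> 0 <= h -> h < del ->
    `|T (t + h) g x - T t g x| <= h * C.
Proof.
move=> bg; have [del del0 Hdel] := trans_increment bg ltr01.
have bL := bfun_jump_op bg; have [_ [M LM]] := bL.
exists (`|M| + 1); first by rewrite ltr_wpDl.
exists del => // t h x t0; rewrite le_eqVlt => /predU1P[<- _|h0 hdel].
  by rewrite addr0 subrr normr0 mul0r.
have A := Hdel t h x t0 h0 hdel.
have B : `|T t (L g) x| <= `|M|.
  apply: norm_trans_le_cst => // y; exact: (le_trans (LM y) (ler_norm M)).
set a := T _ g x in A *; set b := T t g x in A *; set l := T t _ x in A B *.
have -> : a - b = (a - b - h * l) + h * l by ring.
apply: (le_trans (ler_normD _ _)); rewrite normrM (gtr0_norm h0); nra.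
Qed.

Lemma trans_right_continuous (t : R) g x : 0 <= t -> bfun g ->
  T s g x @[s --> t^'+] --> T t g x.
Proof.
move=> t0 bg; have [C C0 [del del0 H]] := trans_lipschitz bg.
apply/cvgrPdist_le => e e0; near=> s.
have st : t < s by near: s; exact: nbhs_right_gt.
have st0 : 0 <= s - t by rewrite subr_ge0 ltW.
have sd : s - t < del.
  by rewrite ltrBlDl; near: s; apply: nbhs_right_lt; rewrite ltrDl.
have := H t (s - t) x t0 st0 sd.
have -> : t + (s - t) = s by ring.
rewrite distrC => /le_trans; apply.
rewrite -ler_pdivlMr// lerBlDl.
near: s; apply: nbhs_right_le; rewrite ltrDl divr_gt0//.
Unshelve. all: by end_near. Qed.

(** The left increments are the right increments at the earlier time [t - h],
    and [T_(t - h) (L g) x] is close to [T_t (L g) x] by [trans_lipschitz]. *)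
Lemma is_derive_trans (t : R) g x : 0 < t -> bfun g ->
  is_derive t (1 : R) (fun s => T s g x) (T t (L g) x).
Proof.
move=> t0 bg; have bL := bfun_jump_op bg.
suff cv : h^-1 *: (T (h *: (1 : R) + t) g x - T t g x) @[h --> (0 : R)^'] -->
    T t (L g) x.
  by split; [apply/cvg_ex; exists (T t (L g) x)|exact: cvg_lim cv].
have [C C0 [d1 d10 HC]] := trans_lipschitz bL.
apply/cvgrPdist_le => e e0.
have e20 : 0 < e / 2 by rewrite divr_gt0.
have [d2 d20 H2] := trans_increment bg e20.
near=> h.
have h0 : h != 0 by near: h; exact: nbhs_dnbhs_neq.
have nh0 : 0 < `|h| by rewrite normr_gt0.
have hd1 : `|h| < d1.
  by near: h; apply: dnbhs0_lt.
have hd2 : `|h| < d2 by near: h; exact: dnbhs0_lt.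
have ht : `|h| < t by near: h; exact: dnbhs0_lt.
have hC : `|h| < (e / 2) / C by near: h; apply: dnbhs0_lt; rewrite divr_gt0.
rewrite -(ler_pM2l nh0) -normrM mulrBr /GRing.scale/= mulrA divff// mul1r mulr1.
have hC2 : `|h| * C <= e / 2 by rewrite -ler_pdivlMr// ltW.
have [hp|hn] := ltP 0 h.
  have := H2 t h x (ltW t0) hp.
  rewrite -[X in X < _ -> _](gtr0_norm hp) => /(_ hd2).
  rewrite distrC [h + t]addrC (gtr0_norm hp) => /le_trans; apply.
  by rewrite ler_pM2l// ler_pdivrMr// ler_peMr ?ler1n// ltW.
have {}hn : h < 0 by rewrite lt_neqAle h0.
have hN : `|h| = - h by rewrite ltr0_norm.
have th0 : 0 <= t + h by rewrite hN in ht; lra.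
have := H2 (t + h) `|h| x th0 nh0 hd2.
have := HC (t + h) `|h| x th0 (ltW nh0) hd1.
rewrite hN addrK [h + t]addrC.
set a := T t g x; set b := T _ g x; set l := T t _ x.
set l' := T _ (L g) x => A B.
have -> : h * l - (b - a) = (a - b - - h * l') - (- h) * (l - l') by ring.
apply: (le_trans (ler_normB _ _)); rewrite normrM normrN hN.
rewrite hN in hC2; nra.
Unshelve. all: by end_near. Qed.

Lemma is_derive_trans_jump (t : R) g x : 0 < t -> bfun g ->
  is_derive t (1 : R) (fun s => T s g x) (L (T t g) x).
Proof.
move=> t0 bg; rewrite -trans_jump_op//; last exact: ltW.
exact: is_derive_trans.
Qed.

(** The derivative is [expR (H t)] times [Q (T_t g) x + (H - h(x)) T_t g x], and
    [H] bounds the jump rate [h(x)]. *)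
Lemma expR_trans_nondecreasing g x (s t : R) : bfun g -> (forall y, 0 <= g y) ->
  0 <= s -> s <= t -> expR (H * s) * T s g x <= expR (H * t) * T t g x.
Proof.
move=> bg g0.
apply: (@ge0_derive_nondecreasing _ (fun s => expR (H * s) * T s g x)
  (fun r => expR (H * r) * (L (T r g) x + H * T r g x))).
- by move=> r r0; apply: is_derive_MexpR; exact: is_derive_trans_jump.
- apply: cvgM; last exact: trans_right_continuous.
  exact/cvg_at_right_filter/continuous_expRM.
- move=> r r0; rewrite mulr_ge0 ?expR_ge0// jump_opE; last exact: bfun_trans.
  have Tg0 : 0 <= T r g x by exact: trans_ge0.
  have : 0 <= Q (T r g) x by apply: kernel_op_ge0 => y; exact: trans_ge0.
  by have := degree_le x; nra.
Qed.

Lemma trans_ge_decay g x (s t : R) : bfun g -> (forall y, 0 <= g y) ->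
  0 <= s -> 0 <= t -> expR (- (H * t)) * T s g x <= T (s + t) g x.
Proof.
move=> bg g0 s0 t0.
have := @expR_trans_nondecreasing g x s (s + t) bg g0 s0.
rewrite lerDl => /(_ t0); rewrite -(ler_pM2l (expR_gt0 (- (H * (s + t))))).
rewrite !mulrA -!expRD addNr expR0 mul1r.
by have -> : - (H * (s + t)) + H * s = - (H * t) by ring.
Qed.

(** [expR (H t) T_t g x] has a derivative at least [Q g x], because
    [expR (H t) T_t g >= g]. *)
Lemma trans1_ge_kernel_op g x : bfun g -> (forall y, 0 <= g y) ->
  expR (- H) * Q g x <= T 1 g x.
Proof.
move=> bg g0.
pose v s := expR (H * s) * T s g x - s * Q g x.
have : v 0 <= v 1.
  apply: (@ge0_derive_nondecreasing _ v
    (fun r => expR (H * r) * (L (T r g) x + H * T r g x) - Q g x)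
    _ _ _ 0 1 (lexx 0) ler01).
  - move=> r r0; rewrite /v; apply: is_derive_Bline.
    by apply: is_derive_MexpR; exact: is_derive_trans_jump.
  - apply: cvgB.
      apply: cvgM; last exact: trans_right_continuous.
      exact/cvg_at_right_filter/continuous_expRM.
    by apply/cvg_at_right_filter; apply: cvgM; [exact: cvg_id|exact: cvg_cst].
  - move=> r r0 /=; have bT := bfun_trans r bg; rewrite jump_opE//.
    have Tg0 : 0 <= T r g x by exact: trans_ge0.
    have : Q g x <= expR (H * r) * Q (T r g) x.
      rewrite /kernel_op -bintZ//; last by apply: bfunM.
      apply: le_bint => //; [exact: bfunM|exact/bfunZ/bfunM|move=> y].
      rewrite mulrCA; apply: ler_wpM2l => //.
      have := @trans_ge_decay g y 0 r bg g0 (lexx _) (ltW r0).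
      rewrite trans0// add0r => h.
      rewrite -(ler_pM2l (expR_gt0 (H * r))) mulrA -expRD subrr in h.
      by rewrite expR0 mul1r in h.
    have dx : 0 <= H - kernel_degree nu k x by rewrite subr_ge0 degree_le.
    have := mulr_ge0 (expR_ge0 (H * r)) (mulr_ge0 dx Tg0).
    set a := expR _; set b := kernel_degree nu k x; set q := Q (T r g) x; lra.
rewrite /v trans0// mulr0 expR0 !mul1r mul0r subr0 mulr1 => h.
rewrite expRN mulrC ler_pdivrMr ?expR_gt0// mulrC.
by have := g0 x; lra.
Qed.

(** For [g >= 0], in [L g] only the gain term [Q g <= c \int g] is positive. *)
Lemma trans_le_add g x (t : R) : bfun g -> (forall y, 0 <= g y) -> 0 <= t ->
  T t g x <= g x + t * (c * \int[nu]_y g y).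
Proof.
move=> bg g0 t0; pose v s := T s g x - s * (c * \int[nu]_y g y).
have : v t <= v 0.
  apply: (@le0_derive_nonincreasing _ v
    (fun r => T r (L g) x - c * \int[nu]_y g y) _ _ _ 0 t (lexx 0) t0).
  - by move=> r r0; rewrite /v; apply: is_derive_Bline; exact: is_derive_trans.
  - apply: cvgB; first exact: trans_right_continuous.
    by apply/cvg_at_right_filter; apply: cvgM; [exact: cvg_id|exact: cvg_cst].
  - move=> r r0 /=; rewrite subr_le0 -(trans_cst r (c * _) x).
    apply: le_trans_op; [exact: bfun_jump_op|exact: bfun_cst|move=> y].
    rewrite jump_opE//; have := kernel_op_le y bg g0.
    by have := degree_ge0 y; have := g0 y; nra.
by rewrite /v trans0// mul0r subr0; lra.
Qed.

(** The derivative of the integral is [\int L (T_t g) = 0]; the increments of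
    [T_t g] being controlled uniformly in [x], no differentiation under the
    integral is needed. *)
Lemma bint_trans g (t : R) : bfun g -> 0 <= t ->
  \int[nu]_x T t g x = \int[nu]_x g x.
Proof.
move=> bg t0.
have -> : \int[nu]_x g x = \int[nu]_x T 0 g x.
  by apply: eq_Rintegral => x _; rewrite trans0.
apply: (@constant_of_small_increments _ (fun t => \int[nu]_x T t g x)) => //.
move=> e e0.
have V1 : 0 < fine (nu setT) + 1 by rewrite ltr_wpDl// fine_ge0.
have e'0 : 0 < e / (fine (nu setT) + 1) by rewrite divr_gt0.
have [del del0 Hdel] := trans_increment bg e'0.
exists del => // s h s0 h0 hd; have bL := bfun_jump_op (bfun_trans s bg).
have b1 := bfun_trans (s + h) bg; have b2 := bfun_trans s bg.
have -> : \int[nu]_x T (s + h) g x - \int[nu]_x T s g x =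
    \int[nu]_x (T (s + h) g x - T s g x - h * L (T s g) x).
  rewrite bintB//; [|exact: bfunB|exact: bfunZ].
  by rewrite bintB// bintZ// jump_op_mean0// mulr0 subr0.
apply: (@le_trans _ _ (h * (e / (fine (nu setT) + 1)) * fine (nu setT))).
  apply: norm_bint_le_cst => //.
    by apply: bfunB; [exact: bfunB|exact: bfunZ].
  by move=> x; rewrite -trans_jump_op// Hdel.
rewrite -mulrA ler_pM2l// mulrAC ler_pdivrMr// ler_pM2l//.
by rewrite lerDl.
Qed.

Lemma bint_norm_trans_le g (t : R) : bfun g -> 0 <= t ->
  \int[nu]_x `|T t g x| <= \int[nu]_x `|g x|.
Proof.
move=> bg t0; have ba := bfun_norm bg; rewrite -(bint_trans ba t0).
apply: le_bint => //; [exact/bfun_norm/bfun_trans|exact: bfun_trans|].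
by move=> x; exact: norm_trans_le.
Qed.

Let c_ge0 (x : X) : 0 <= c.
Proof. exact: le_trans (k_ge0 x x) (k_le x x). Qed.

(** The law of the process at time [t] is at most [delta_x + t c nu]. *)
Lemma ge0_integral_kappa_le (G : X -> R) (t : R) x : measurable_fun setT G ->
  (forall y, 0 <= G y) -> 0 <= t ->
  (\int[kappa t x]_y (G y)%:E <=
   (G x)%:E + (t * c)%:E * \int[nu]_y (G y)%:E)%E.
Proof.
move=> mG G0 t0.
have nd y (a b : nat) : (a <= b)%N ->
    ((truncate G a y)%:E <= (truncate G b y)%:E)%E.
  move=> ab; rewrite lee_fin /truncate ger0_norm//.
  case: ifPn => [Ga|_]; last by case: ifPn.
  by rewrite ifT// (le_trans Ga)// ler_nat.
have tr0 n y : 0 <= truncate G n y by rewrite /truncate; case: ifP.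
have trG n y : truncate G n y <= G y.
  apply: le_trans (ler_norm _) _; apply: le_trans (truncate_le _ _ _) _.
  by rewrite ger0_norm.
have bt n : bfun (truncate G n) by exact: bfun_truncate.
have mt n : measurable_fun setT (EFin \o truncate G n).
  by apply/measurable_EFinP; exact: (bt n).1.
have cvG (mu : {measure set X -> \bar R}) :
    (\int[mu]_y (truncate G n y)%:E @[n --> \oo] --> \int[mu]_y (G y)%:E)%E.
  have := @cvg_monotone_convergence _ _ _ mu setT measurableT
    (fun n y => (truncate G n y)%:E) mt (fun n y _ => tr0 n y)
    (fun y _ => nd y).
  under eq_integral => y _.
    rewrite (_ : limn _ = (G y)%:E); last first.
      apply/cvg_lim => //; apply: cvg_EFin; first exact: nearW.
      exact: cvg_truncate.
    over.
  by [].
apply: (cvge_to_le (cvG (kappa t x))).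
apply: nearW => n.
rewrite -EFin_bint//; apply: (@le_trans _ _ (truncate G n x +
  t * (c * \int[nu]_y truncate G n y))%:E).
  by rewrite lee_fin; exact: trans_le_add.
rewrite mulrA EFinD EFinM; apply: leeD.
  by rewrite lee_fin.
apply: lee_wpmul2l; first by rewrite lee_fin mulr_ge0// (c_ge0 x).
rewrite EFin_bint//; apply: ge0_le_integral => //.
- by move=> y _; rewrite lee_fin.
- exact: mt.
- exact/measurable_EFinP.
- by move=> y _; rewrite lee_fin.
Qed.

Lemma kappa_integrable (G : X -> R) (t : R) x : 0 <= t ->
  nu.-integrable setT (EFin \o G) -> (kappa t x).-integrable setT (EFin \o G).
Proof.
move=> t0 /integrableP[mG iG]; apply/integrableP; split => //.
have mn : measurable_fun setT (fun y => `|G y|).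
  by apply: measurableT_comp => //; exact/measurable_EFinP.
apply: (@le_lt_trans _ _ (`|G x|%:E + (t * c)%:E * \int[nu]_y `|G y|%:E)%E).
  exact: ge0_integral_kappa_le.
rewrite lte_add_pinfty ?ltry// lte_mul_pinfty//.
by rewrite lee_fin mulr_ge0// (c_ge0 x).
Qed.

Lemma kernel_op_integrable u x : nu.-integrable setT (EFin \o u) ->
  nu.-integrable setT (fun y => (k x y * u y)%:E).
Proof.
move=> iu; have cu : nu.-integrable setT (fun y => (c * u y)%:E).
  by under eq_fun do rewrite EFinM; exact: integrableZl.
have [/measurable_EFinP mu_ _] := integrableP _ _ _ iu.
apply: le_integrable cu => //.
  by apply/measurable_EFinP; apply: measurable_funM => //; exact: (bkx x).1.
by move=> y _; rewrite lee_fin !normrM ler_wpM2r// !ger0_norm// (c_ge0 x).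
Qed.

Lemma jump_op_integrableE u x : nu.-integrable setT (EFin \o u) ->
  L u x = Q u x - kernel_degree nu k x * u x.
Proof.
move=> iu; rewrite /jump_op /kernel_op /kernel_degree mulrC.
rewrite -bintZ// -RintegralB//.
- by apply: eq_Rintegral => y _; ring.
- exact: kernel_op_integrable.
- by apply: bfun_integrable => //; exact: bfunZ.
Qed.

Section minorized.
Variables (B : set X) (m eps : R).
Hypotheses (mB : measurable B) (B_gt0 : (0 < nu B)%E) (m_gt0 : 0 < m)
  (eps_gt0 : 0 < eps)
  (minor : forall g, bfun g -> (forall y, 0 <= g y) -> forall x, B x ->
    eps * \int[nu]_y g y <= T m g x).

(** Doeblin's argument, in L1. With [N = \int |g|], both [|g| + g] and [|g| - g]
    are nonnegative with integral [N], so that [T_m |g| + T_m g] and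
    [T_m |g| - T_m g] are at least [e N] on [B]. Hence
    [|T_m g| <= T_m |g| - e N 1_B], and [T_m] preserves integrals. *)
Lemma trans_L1_contraction : exists2 rho : R, 0 < rho < 1 &
  forall g, bfun g -> \int[nu]_x g x = 0 ->
    \int[nu]_x `|T m g x| <= rho * \int[nu]_x `|g x|.
Proof.
have nB0 : 0 < fine (nu B) by rewrite fine_gt0// B_gt0 ltey_eq fin_num_measure.
(* lowering the constant keeps the contraction factor at least 1/2 *)
pose e := Num.min eps (2 * fine (nu B))^-1.
have e0 : 0 < e by rewrite lt_min eps_gt0 invr_gt0 mulr_gt0.
have eB : e * fine (nu B) <= 2^-1.
  apply: (@le_trans _ _ ((2 * fine (nu B))^-1 * fine (nu B))).
    by rewrite ler_pM2r// ge_min lexx orbT.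
  by rewrite invfM mulrAC mulfK// gt_eqF.
exists (1 - e * fine (nu B)).
  have := mulr_gt0 e0 nB0; lra.
move=> g bg g0.
have bn := bfun_norm bg; have bT := bfun_trans m bg.
set N := \int[nu]_x `|g x|.
have N0 : 0 <= N by exact: bint_ge0.
have half h x : bfun h -> (forall y, `|h y| = `|g y|) -> \int[nu]_y h y = 0 ->
    e * N * \1_B x <= T m (fun y => `|g y|) x + T m h x.
  move=> bh hg h0; have gh0 y : 0 <= `|g y| + h y.
    by rewrite -hg; have := ler_norm (- h y); rewrite normrN; lra.
  rewrite -transD//; have [Bx|nBx] := pselect (B x); last first.
    by rewrite indicE memNset// mulr0; exact: trans_ge0.
  rewrite indicE mem_set// mulr1; apply: le_trans (minor (bfunD bn bh) gh0 Bx).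
  by rewrite bintD// h0 addr0 ler_pM// ?(ltW e0)// ge_min lexx.
have -> : (1 - e * fine (nu B)) * N =
    \int[nu]_x (T m (fun y => `|g y|) x - e * N * \1_B x).
  rewrite bintB//; [|exact: bfun_trans|exact/bfunZ/bfun_indic].
  rewrite bint_trans ?ltW// bintZ//; last exact: bfun_indic.
  have -> : \int[nu]_x \1_B x = fine (nu B).
    by rewrite /Rintegral integral_indic// setIT.
  rewrite -/N; ring.
apply: le_bint => //; first exact: bfun_norm.
  by apply: bfunB; [exact: bfun_trans|exact/bfunZ/bfun_indic].
move=> x; rewrite ler_norml.
have := half g x bg (fun=> erefl) g0.
have := half (fun y => -1 * g y) x (bfunZ _ bg).
rewrite transZ// bintZ// g0 mulr0 => /(_ _ erefl) h1 h2.
have {}h1 := h1 (fun y => ltac:(by rewrite normrM normrN1 mul1r)).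
by apply/andP; split; lra.
Qed.

Lemma trans_L1_decay : exists C b : R, [/\ 0 < C, 0 < b &
  forall g (t : R), bfun g -> \int[nu]_x g x = 0 -> 0 <= t ->
    \int[nu]_x `|T t g x| <= C * expR (- (b * t)) * \int[nu]_x `|g x|].
Proof.
have [rho /andP[rho0 rho1] Hrho] := trans_L1_contraction.
have iter (j : nat) (r : R) g : bfun g -> \int[nu]_x g x = 0 -> 0 <= r ->
    \int[nu]_x `|T (j%:R * m + r) g x| <= rho ^+ j * \int[nu]_x `|g x|.
  move=> bg g0 r0; elim: j => [|j IH].
    by rewrite mul0r add0r expr0 mul1r bint_norm_trans_le.
  have jr0 : 0 <= j%:R * m + r by rewrite addr_ge0// mulr_ge0// ltW.
  have -> : j.+1%:R * m + r = m + (j%:R * m + r) by rewrite -natr1; ring.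
  under eq_Rintegral do rewrite trans_semigroup// ?(ltW m_gt0)//.
  apply: (le_trans (Hrho _ (bfun_trans _ bg) _)); first by rewrite bint_trans.
  by rewrite exprS -mulrA ler_pM2l.
pose a := - ln rho.
have a0 : 0 < a by rewrite oppr_gt0 ln_lt0// rho0.
exists (expR a), (a / m); split => [||g t bg g0 t0]; first exact: expR_gt0.
  by rewrite divr_gt0.
pose j := Num.truncn (t / m).
have tm0 : 0 <= t / m by rewrite divr_ge0// ltW.
have jt : j%:R <= t / m by rewrite truncn_le.
have tj : t / m < j%:R + 1 by rewrite natr1 truncnS_gt.
have r0 : 0 <= t - j%:R * m by rewrite subr_ge0 -ler_pdivlMr.
have := iter j (t - j%:R * m) g bg g0 r0.
rewrite addrC subrK => /le_trans; apply.
apply: ler_wpM2r; first exact: bint_ge0.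
have -> : rho = expR (- a) by rewrite /a opprK lnK.
rewrite -expRM_natr -expRD ler_expR.
have -> : a / m * t = a * (t / m) by ring.
nra.
Qed.

(** [v t = T_t g x] solves [v' = Q (T_t g) x - a v] with [a > 0] the degree of
    [x], and the source term is at most a multiple of the L1 norm of [T_t g],
    which decays. Taking the rate [b] smaller than [a], [D N expR (- b t)] is a
    supersolution of this equation. *)
Lemma trans_pointwise_decay x : 0 < kernel_degree nu k x ->
  exists C b : R, [/\ 0 < C, 0 < b &
  forall g (t : R), bfun g -> \int[nu]_x g x = 0 -> 0 <= t ->
    `|T t g x| <= C * expR (- (b * t)) * (`|g x| + \int[nu]_x `|g x|)].
Proof.
move=> dx0; have [C0 [b0 [C00 b00 Hdecay]]] := trans_L1_decay.
have c0 : 0 <= c by apply: le_trans (k_ge0 x x) (k_le x x).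
pose a := kernel_degree nu k x.
pose b := Num.min b0 (a / 2).
have b_gt0 : 0 < b by rewrite lt_min b00 divr_gt0.
have ba : b < a by rewrite gt_min ltr_pdivrMr// ltr_pMr// ltr1n orbT.
have bb0 : b <= b0 by rewrite ge_min lexx.
pose D := c * C0 / (a - b).
have ab0 : 0 < a - b by rewrite subr_gt0.
have D0 : 0 <= D.
  by apply: divr_ge0; [apply: mulr_ge0 => //; exact: ltW|exact: ltW].
have upper g (t : R) : bfun g -> \int[nu]_x g x = 0 -> 0 <= t ->
    T t g x <= expR (- (b * t)) * (`|g x| + D * \int[nu]_x `|g x|).
  move=> bg g0 t0; set N := \int[nu]_x `|g x|.
  have N0 : 0 <= N by exact: bint_ge0.
  pose v s := expR (a * s) * (T s g x - D * N * expR (- b * s)).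
  have : v t <= v 0.
    apply: (@le0_derive_nonincreasing _ v (fun s => expR (a * s) *
       ((L (T s g) x - D * N * (- b * expR (- b * s))) +
        a * (T s g x - D * N * expR (- b * s)))) _ _ _ 0 t (lexx 0) t0).
    - move=> r r0; apply: is_derive_MexpR.
      apply: is_deriveB; first exact: is_derive_trans_jump.
      exact: (is_deriveZ _ (is_derive_expRM _ _)).
    - apply: cvgM; first exact/cvg_at_right_filter/continuous_expRM.
      apply: cvgB; first exact: trans_right_continuous.
      apply: cvgM; first exact: cvg_cst.
      exact/cvg_at_right_filter/continuous_expRM.
    - move=> r r0 /=; rewrite pmulr_rle0 ?expR_gt0//.
      rewrite jump_opE; last exact: bfun_trans.
      have : Q (T r g) x <= c * (C0 * expR (- b * r) * N).
        apply: (le_trans (ler_norm _)).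
        apply: (le_trans (norm_kernel_op_le x (bfun_trans r bg))).
        apply: ler_wpM2l => //; apply: (le_trans (Hdecay g r bg g0 (ltW r0))).
        apply: ler_wpM2r => //; rewrite ler_pM2l// ler_expR mulNr lerN2.
        by rewrite ler_pM2r.
      have -> : c * (C0 * expR (- b * r) * N) =
          (a - b) * (D * N * expR (- b * r)).
        by rewrite /D; field; rewrite gt_eqF.
      rewrite -/a; lra.
  rewrite /v mulr0 expR0 mul1r trans0// mulr0 expR0 mulr1.
  rewrite -(ler_pM2l (expR_gt0 (- (a * t)))) mulrA -expRD addNr expR0 mul1r.
  have DN0 : 0 <= D * N by rewrite mulr_ge0.
  have : expR (- (a * t)) <= expR (- (b * t)).
    by rewrite ler_expR lerN2 ler_wpM2r// ltW.
  rewrite mulNr; have := expR_ge0 (- (a * t)).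
  have := ler_norm (g x); have := normr_ge0 (g x).
  set p := expR (- (a * t)); set q := expR (- (b * t)); set y := `|g x|.
  move=> y0 gy p0 pq h.
  have : p * (g x - D * N) <= q * y by nra.
  lra.
exists (1 + D), b; split => //; first by rewrite ltr_wpDr.
move=> g t bg g0 t0.
have h1 := upper g t bg g0 t0.
have := upper (fun y => -1 * g y) t (bfunZ _ bg).
rewrite bintZ// g0 mulr0 transZ// => /(_ erefl t0) h2.
have E z : `|-1 * g z| = `|g z| by rewrite normrM normrN1 mul1r.
rewrite E in h2.
have E2 : \int[nu]_z `|-1 * g z| = \int[nu]_z `|g z|.
  by apply: eq_Rintegral => z _.
rewrite E2 in h2.
have N0 : 0 <= \int[nu]_x `|g x| by exact: bint_ge0.
apply: (@le_trans _ _ (expR (- (b * t)) * (`|g x| + D * \int[nu]_x `|g x|))).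
  by rewrite ler_norml; apply/andP; split; lra.
rewrite [X in _ <= X * _]mulrC -[leRHS]mulrA ler_pM2l ?expR_gt0//.
by have := normr_ge0 (g x); nra.
Qed.

(** Time integrals over [[0, n]] of the truncated and recentred functions [w_n]
    are given by the fundamental theorem of calculus: they are
    [T_n w_n x - w_n x], and [T_n w_n x] tends to 0 because the decay estimate
    depends on [w_n] only through [|w_n x|] and its L1 norm. The same estimate,
    applied to [L w_n], dominates the integrands by an exponential. *)
Theorem potential_formula u x : 0 < kernel_degree nu k x ->
  measurable_fun setT u -> nu.-integrable setT (EFin \o u) ->
  \int[nu]_y u y = 0 ->
  [/\ forall t : R, 0 <= t -> (kappa t x).-integrable setT (EFin \o L u),
     lebesgue_measure.-integrable `[0%R, +oo[
       (fun t : R => \int[kappa t x]_y (L u y)%:E)%E &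
     (u x)%:E = (- \int[lebesgue_measure]_(t in `[0%R, +oo[)
       \int[kappa t x]_y (L u y)%:E)%E].
Proof.
move=> dx0 mu_ iu u0.
have [C [b [C0 b0 decay]]] := trans_pointwise_decay dx0.
have V0 : 0 < fine (nu setT).
  rewrite fine_gt0// ltey_eq fin_num_measure// andbT.
  by apply: (lt_le_trans B_gt0); apply: le_measure; rewrite ?inE.
have iau : nu.-integrable setT (fun y => `|u y|%:E) by exact: integrable_norm.
pose N := \int[nu]_y `|u y|.
have N0 : 0 <= N by exact: bint_ge0.
pose un n := truncate u n.+1.
have bun n : bfun (un n) by exact: bfun_truncate.
have cun y : un n y @[n --> \oo] --> u y.
  have := @cvg_truncate _ X R u y.
  by rewrite -(cvg_shiftS (fun n => truncate u n y)).
have unle n y : `|un n y| <= `|u y| by exact: truncate_le.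
have nun n : \int[nu]_y `|un n y| <= N.
  apply: le_Rintegral => //; apply: bfun_integrable => //; exact: bfun_norm.
(* L ignores constants, so recentring the truncations does not affect L *)
pose a n := \int[nu]_y un n y / fine (nu setT).
have ca : a n @[n --> \oo] --> 0.
  rewrite -(mul0r (fine (nu setT))^-1) -u0; apply: cvgMl.
  apply: (proj2 (Rdominated_cvg (g := fun y => `|u y|) _ _ _ _)) => // n.
  exact: (bun n).1.
pose w n y := un n y - a n.
have bw n : bfun (w n) by apply: bfunB => //; exact: bfun_cst.
have w0 n : \int[nu]_y w n y = 0.
  rewrite bintB//; last exact: bfun_cst.
  by rewrite bint_cst// /a divfK ?subrr// gt_eqF.
have Lw n : L (w n) = L (un n).
  by apply/funext => y; apply: eq_Rintegral => z _; rewrite /w; ring.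
pose G y := c * N + H * `|u y|.
have iG : nu.-integrable setT (EFin \o G).
  have -> : EFin \o G = (fun y => ((c * N)%:E + (H%:E * `|u y|%:E))%E).
    by apply/funext => y; rewrite -EFinM -EFinD.
  apply: integrableD => //; last exact: integrableZl.
  exact: (bfun_integrable nufin (bfun_cst X (c * N))).
have LG n y : `|L (un n) y| <= G y.
  rewrite jump_opE// (le_trans (ler_normB _ _))// lerD//.
    apply: (le_trans (norm_kernel_op_le y (bun n))).
    by rewrite ler_wpM2l// (c_ge0 x).
  rewrite normrM ger0_norm ?degree_ge0//; apply: ler_pM => //.
    exact: degree_ge0.
  exact: degree_le.
have cL y : L (un n) y @[n --> \oo] --> L u y.
  under eq_fun do rewrite jump_opE//.
  rewrite jump_op_integrableE//; apply: cvgB; last first.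
    by apply: cvgM => //; exact: cvg_cst.
  apply: (proj2 (Rdominated_cvg (g := fun z => c * `|u z|) _ _ _ _)) => //.
  - by move=> n; apply: measurable_funM; [exact: (bkx y).1|exact: (bun n).1].
  - by move=> z; apply: cvgM => //; exact: cvg_cst.
  - have -> : EFin \o (fun z => c * `|u z|) =
        (fun z => c%:E * `|u z|%:E)%E by [].
    exact: integrableZl.
  - by move=> n z; rewrite normrM ger0_norm//; apply: ler_pM.
have key t : 0 <= t -> (kappa t x).-integrable setT (EFin \o L u) /\
    T t (L (un n)) x @[n --> \oo] --> \int[kappa t x]_y L u y.
  move=> t0; apply: (Rdominated_cvg (g := G)) => //.
    by move=> n; exact: (bfun_jump_op (bun n)).1.
  exact: kappa_integrable.
have bLu n : bfun (L (un n)) by exact: bfun_jump_op.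
have Tcont g : bfun g -> {within `[0%R, +oo[, continuous (fun s => T s g x)}.
  move=> bg; apply: derivable_oy_Rcontinuous_within_itvcy; split.
    move=> s; rewrite in_itv/= andbT => s0.
    by have [] := is_derive_trans x s0 bg.
  exact: trans_right_continuous.
have mitv : measurable (`[0%R, +oo[%classic : set R) by exact: measurable_itv.
(* cutting off at time n.+1 lets one dominated convergence take the limit in the
   truncation height and in the length of the time interval together *)
pose F n (s : R) := ((fun s => T s (L (un n)) x) \_ `[0%R, n.+1%:R]) s.
have mF n : measurable_fun (`[0%R, +oo[%classic : set R) (F n).
  apply: (measurable_restrict _ (measurable_itv _) mitv).1.
  apply: (measurable_funS mitv); first exact: subIsetl.
  exact: subspace_continuous_measurable_fun (Tcont _ (bLu n)).
pose K := G x + \int[nu]_y G y.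
have G0 y : 0 <= G y.
  rewrite addr_ge0// mulr_ge0// ?(c_ge0 x)//.
  exact: le_trans (degree_ge0 x) (degree_le x).
have K0 : 0 <= K by rewrite addr_ge0// bint_ge0.
have FK n s : 0 <= s -> `|F n s| <= C * K / b * exponential_pdf b s.
  move=> s0; rewrite exponential_pdfE//.
  have -> : C * K / b * (b * expR (- b * s)) = C * expR (- (b * s)) * K.
    by rewrite mulNr; field; rewrite gt_eqF.
  rewrite /F patchE; case: ifPn => _; last first.
    by rewrite normr0 !mulr_ge0// ?expR_ge0// ltW.
  have := @decay (L (un n)) s (bLu n) (jump_op_mean0 (bun n)) s0.
  move=> /le_trans; apply; apply: ler_wpM2l.
    by rewrite mulr_ge0// ?expR_ge0// ltW.
  apply: lerD => //; apply: le_Rintegral => //.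
  by apply: bfun_integrable => //; exact: bfun_norm.
have cF s : 0 <= s ->
    (F n s)%:E @[n --> \oo] --> (\int[kappa s x]_y (L u y)%:E)%E.
  move=> s0; have [iLu cT] := key s s0.
  rewrite -(fineK (integrable_fin_num measurableT iLu)).
  apply: cvg_EFin; first exact: nearW.
  apply: cvg_trans cT; apply: near_eq_cvg.
  exists (Num.truncn s) => // n /= sn.
  rewrite /F patchE ifT// inE/= in_itv/= s0/=.
  by rewrite (le_trans (ltW (truncnS_gt s)))// ler_nat.
have [|||||iPhi _ cPhi] := @dominated_convergence _ _ R lebesgue_measure
  (`[0%R, +oo[%classic : set R) mitv
  (fun n s => (F n s)%:E) (fun s => \int[kappa s x]_y (L u y)%:E)%E
  (fun s => (C * K / b * exponential_pdf b s)%:E).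
- by move=> n; apply/measurable_EFinP; exact: mF.
- apply: (emeasurable_fun_cvg (fun n s => (F n s)%:E)).
    by move=> n; apply/measurable_EFinP; exact: mF.
  by move=> s /=; rewrite in_itv/= andbT => s0; exact: cF.
- by apply: aeW => s /=; rewrite in_itv/= andbT => s0; exact: cF.
- have ipdf : lebesgue_measure.-integrable (`[0%R, +oo[%classic : set R)
      (EFin \o exponential_pdf b).
    exact: integrableS (integrable_exponential_pdf b0).
  by apply: (integrableZl _ (C * K / b) ipdf).
- apply: aeW => s n /=; rewrite in_itv/= andbT => s0.
  by rewrite lee_fin; exact: FK.
split => //; first by move=> t t0; have [] := key t t0.
have intF n : (\int[lebesgue_measure]_(s in `[0%R, +oo[) (F n s)%:E =
    (T n.+1%:R (w n) x - w n x)%:E)%E.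
  rewrite -[in w n x](trans0 x (bw n)) EFinB.
  have n0 : (0 : R) < n.+1%:R by rewrite ltr0n.
  rewrite -(@continuous_FTC2 _ (fun s => T s (L (un n)) x)
    (fun s => T s (w n) x) 0 n.+1%:R n0).
  - rewrite [LHS](_ : _ = \int[lebesgue_measure]_(s in `[0%R, +oo[)
      ((EFin \o (fun s => T s (L (un n)) x)) \_ `[0%R, n.+1%:R]) s)%E;
      last first.
      by apply: eq_integral => s _; rewrite /F !patchE; case: ifP.
    rewrite -integral_mkcondr; congr (integral _ _ _).
    apply/seteqP; split => s /=; rewrite !in_itv/= andbT; first by case.
    by move=> /andP[-> ->].
  - apply: (continuous_subspaceW _ (Tcont _ (bLu n))).
    by move=> s /=; rewrite !in_itv/= andbT => /andP[].
  - split.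
    + move=> s; rewrite in_itv/= => /andP[s0 _].
      by have [] := is_derive_trans x s0 (bw n).
    + exact: trans_right_continuous.
    + apply: cvg_at_left_filter; apply: differentiable_continuous.
      by apply/derivable1_diffP; have [] := is_derive_trans x n0 (bw n).
  - move=> s; rewrite in_itv/= => /andP[s0 _]; rewrite derive1E.
    by have [_ ->] := is_derive_trans x s0 (bw n); rewrite Lw.
have cw : w n x @[n --> \oo] --> u x.
  by rewrite -[u x]subr0; apply: cvgB.
have cT0 : T n.+1%:R (w n) x @[n --> \oo] --> 0.
  pose K' := `|u x| + N / fine (nu setT) + (N + N).
  have an n : `|a n| <= N / fine (nu setT).
    rewrite /a normrM (ger0_norm (x := _^-1)) ?invr_ge0 ?(ltW V0)//.
    rewrite ler_pM2r ?invr_gt0//; apply: le_trans (nun n); exact: le_norm_bint.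
  have wle n y : `|w n y| <= `|un n y| + N / fine (nu setT).
    by rewrite (le_trans (ler_normB _ _))// lerD.
  have Tle n : `|T n.+1%:R (w n) x| <= C * K' * (expR (- b)) ^+ n.+1.
    have := @decay (w n) n.+1%:R (bw n) (w0 n) (ler0n _ _).
    rewrite -expRM_natr mulNr => /le_trans; apply.
    rewrite mulrAC ler_wpM2r ?expR_ge0// ler_pM2l//.
    apply: lerD; first by apply: (le_trans (wle n x)); rewrite lerD2r.
    apply: (@le_trans _ _ (\int[nu]_y (`|un n y| + N / fine (nu setT)))).
      apply: le_bint => //; first exact: bfun_norm.
      by apply: bfunD; [exact: bfun_norm|exact: bfun_cst].
    rewrite bintD//; [|exact: bfun_norm|exact: bfun_cst].
    by rewrite bint_cst// divfK ?gt_eqF// lerD2r.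
  have eb : `|expR (- b)| < 1.
    by rewrite ger0_norm ?expR_ge0// expR_lt1 oppr_lt0.
  have lim0 : C * K' * expR (- b) ^+ n.+1 @[n --> \oo] --> 0.
    rewrite -(mulr0 (C * K')); apply: cvgM; first exact: cvg_cst.
    by have := cvg_expr eb; rewrite -(cvg_shiftS (fun n => expR (- b) ^+ n)).
  apply/norm_cvg0P; apply: squeeze_cvgr (cvg_cst 0) lim0.
  by apply: nearW => n; rewrite normr_ge0/=.
have : (- u x)%:E = (\int[lebesgue_measure]_(t in `[0%R, +oo[)
       \int[kappa t x]_y (L u y)%:E)%E.
  apply: cvg_unique cPhi => //.
  rewrite (_ : [sequence _]_n = fun n => (T n.+1%:R (w n) x - w n x)%:E);
    last first.
    by apply/funext => n; rewrite /= intF.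
  apply: cvg_EFin; first exact: nearW.
  by rewrite -[- u x]sub0r; apply: cvgB.
by move=> <-; rewrite -EFinN opprK.
Qed.

End minorized.

End jump_semigroup.

(** * Minorization on a connected compact set *)

Section minorization.
Context (R : realType) (N : nat).
Notation Rn := (Rn R N).
Implicit Types g : Rn -> R.
Variables (nu : {finite_measure set Rn -> \bar R}) (k : Rn -> Rn -> R) (c : R).
Variable kappa : R -> R.-pker Rn ~> Rn.
Hypothesis JS : jump_semigroup nu k kappa c.
Variable E : set Rn.
Hypotheses (cE : compact E) (mE : measurable E) (connE : connected E)
  (nuE : nu (~` E) = 0%E)
  (nu_gt0 : forall U : set Rn, open U -> U `&` E !=set0 -> (0 < nu (U `&` E))%E)
  (k_loc : forall y, E y -> exists U : set Rn, exists e : R,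
    [/\ open U, U y, 0 < e &
      forall x z, U x -> E x -> U z -> E z -> e <= k x z]).

Local Notation T := (trans kappa).
Local Notation H := (c * fine (nu setT)).

Let nufin : (nu setT < +oo)%E.
Proof. by rewrite -ge0_fin_numE// fin_num_measure. Qed.

(** Mass moves from [U] to [B]: within some time [m] the semigroup carries a
    definite proportion of the [nu]-mass of [g] on [U] to every point of [B]. *)
Definition minorized (B U : set Rn) := exists (m : nat) (e : R), 0 < e /\
  forall g, bfun g -> (forall y, 0 <= g y) -> forall x, B x ->
    e * \int[nu]_y (g y * \1_(U `&` E) y) <= T m%:R g x.

Let mUE (U : set Rn) : open U -> measurable (U `&` E).
Proof. by move=> oU; apply: measurableI => //; exact: open_measurable_Rn. Qed.

Let bfunUE (U : set Rn) g : open U -> bfun g ->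
  bfun (fun y => g y * \1_(U `&` E) y).
Proof. by move=> oU bg; apply: (bfunM bg); apply/bfun_indic/mUE. Qed.

Let int_ge0 (U : set Rn) g : (forall y, 0 <= g y) ->
  0 <= \int[nu]_y (g y * \1_(U `&` E) y).
Proof. by move=> g0; apply: bint_ge0 => y; rewrite mulr_ge0. Qed.

Let trans1_local (U : set Rn) (e : R) g x : open U -> 0 < e ->
  (forall x z, U x -> E x -> U z -> E z -> e <= k x z) -> bfun g ->
  (forall y, 0 <= g y) -> U x -> E x ->
  expR (- H) * e * \int[nu]_y (g y * \1_(U `&` E) y) <= T 1 g x.
Proof.
move=> oU e0 kU bg g0 Ux Ex.
apply: le_trans (trans1_ge_kernel_op JS x bg g0).
rewrite -mulrA ler_pM2l; last exact: expR_gt0.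
rewrite -bintZ; [|exact: nufin|exact: bfunUE].
apply: (le_bint nufin); [exact/bfunZ/bfunUE|exact: (bfun_kernel_section JS)|].
move=> y; rewrite indicE; case: (boolP (_ \in _)) => [|_].
  rewrite inE => -[Uy Ey]; rewrite mulr1; apply: (ler_wpM2r (g0 y)).
  exact: kU.
by rewrite !mulr0; apply: mulr_ge0; [exact: (jump_ge0 JS)|exact: g0].
Qed.

Lemma minorized_local (U : set Rn) (e : R) : open U -> 0 < e ->
  (forall x z, U x -> E x -> U z -> E z -> e <= k x z) ->
  minorized (U `&` E) U.
Proof.
move=> oU e0 kU; exists 1%N, (expR (- H) * e); split.
  by rewrite mulr_gt0// expR_gt0.
by move=> g bg g0 x [Ux Ex]; exact: trans1_local.
Qed.

(** One more unit of time brings the mass of [U] to [V], through the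
    nonnegligible overlap of [U] and [V], and from there it goes to [B]. *)
Lemma minorized_step (B V U : set Rn) (e : R) : open V -> minorized B V ->
  open U -> 0 < e ->
  (forall x z, U x -> E x -> U z -> E z -> e <= k x z) ->
  V `&` U `&` E !=set0 -> minorized B U.
Proof.
move=> oV [m [e' [e'0 HV]]] oU e0 kU VUE.
have oVU : open (V `&` U) by exact: openI.
have nVU : 0 < fine (nu (V `&` U `&` E)).
  by rewrite fine_gt0// nu_gt0//= ltey_eq fin_num_measure//; exact: mUE.
exists m.+1, (e' * (expR (- H) * e * fine (nu (V `&` U `&` E)))); split.
  by rewrite !mulr_gt0// expR_gt0.
move=> g bg g0 x Bx.
rewrite -natr1 (trans_semigroup JS)// -mulrA.
have bT := bfun_trans kappa 1 bg.
have T0 y : 0 <= T 1 g y by exact: trans_ge0.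
apply: le_trans (HV _ bT T0 x Bx).
rewrite (ler_pM2l e'0); set I := \int[nu]_y _.
have -> : fine (nu (V `&` U `&` E)) = \int[nu]_y \1_(V `&` U `&` E) y.
  by rewrite /Rintegral integral_indic ?setIT//; exact: mUE.
rewrite mulrAC -bintZ; [|exact: nufin|exact/bfun_indic/mUE].
apply: (le_bint nufin); [exact/bfunZ/bfun_indic/mUE|exact: bfunUE|].
move=> y; rewrite !indicE; case: (boolP (y \in V `&` U `&` E)).
  rewrite inE => -[[Vy Uy] Ey]; rewrite mem_set//= !mulr1.
  exact: (trans1_local oU e0 kU bg g0 Uy Ey).
by rewrite mulr0 => _; exact: mulr_ge0.
Qed.

Lemma minorized0 (B : set Rn) : minorized B set0.
Proof.
exists 0%N, 1; split=> // g bg g0 x Bx.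
rewrite (_ : \int[nu]_y _ = 0) ?mulr0 ?trans_ge0// set0I.
under eq_Rintegral do rewrite indicE in_set0 mulr0.
by rewrite bint_cst mul0r.
Qed.

(** The sum of the two times serves for both sets, up to the exponential loss
    of [trans_ge_decay]. *)
Lemma minorizedU (B U V : set Rn) : open U -> open V ->
  minorized B U -> minorized B V -> minorized B (U `|` V).
Proof.
move=> oU oV [m [a [a0 HU]]] [n [b [b0 HV]]].
pose a' := expR (- (H * n%:R)) * a; pose b' := expR (- (H * m%:R)) * b.
have a'0 : 0 < a' by rewrite mulr_gt0// expR_gt0.
have b'0 : 0 < b' by rewrite mulr_gt0// expR_gt0.
exists (m + n)%N, (Num.min a' b' / 2); split.
  by rewrite divr_gt0// lt_min a'0.
move=> g bg g0 x Bx; have oUV : open (U `|` V) by exact: openU.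
set I := \int[nu]_y _.
have I0 : 0 <= I by exact: int_ge0.
pose IU := \int[nu]_y (g y * \1_(U `&` E) y).
pose IV := \int[nu]_y (g y * \1_(V `&` E) y).
have IUV : I <= IU + IV.
  rewrite -bintD; [|exact: nufin|exact: bfunUE|exact: bfunUE].
  apply: (le_bint nufin); [exact: bfunUE|apply: bfunD; exact: bfunUE|].
  move=> y; rewrite -mulrDr ler_wpM2l// !indicE setIUl in_setU.
  by case: (_ \in _); case: (_ \in _); rewrite /= ?addr0 ?add0r ?lerDl.
have hU : a' * IU <= T (m + n)%:R g x.
  rewrite natrD.
  apply: le_trans (trans_ge_decay JS x bg g0 (ler0n _ m) (ler0n _ n)).
  by rewrite /a' -mulrA ler_pM2l ?expR_gt0//; exact: HU.
have hV : b' * IV <= T (m + n)%:R g x.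
  rewrite natrD addrC.
  apply: le_trans (trans_ge_decay JS x bg g0 (ler0n _ n) (ler0n _ m)).
  by rewrite /b' -mulrA ler_pM2l ?expR_gt0//; exact: HV.
have IU0 : 0 <= IU by exact: int_ge0.
have IV0 : 0 <= IV by exact: int_ge0.
have : Num.min a' b' * IU <= a' * IU by rewrite ler_wpM2r// ge_min lexx.
have : Num.min a' b' * IV <= b' * IV by rewrite ler_wpM2r// ge_min lexx orbT.
have mn0 : 0 < Num.min a' b' by rewrite lt_min a'0.
have := ler_wpM2l (ltW mn0) IUV; lra.
Qed.

(** The points of [E] with a neighbourhood whose mass can be moved to [B] form
    an open and, by [minorized_step], closed subset of the connected set [E]. *)
Lemma minorized_point (y0 : Rn) : E y0 -> exists B : set Rn,
  [/\ open B, B y0 & forall y, E y ->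
    exists U : set Rn, [/\ open U, U y & minorized (B `&` E) U]].
Proof.
move=> Ey0; have [B [e0 [oB By0 e00 kB]]] := k_loc Ey0.
exists B; split=> //.
pose O := \bigcup_(U in [set U | open U /\ minorized (B `&` E) U]) U.
have oO : open O by apply: bigcup_open => U [].
suff EO : E `&` O = E.
  move=> y Ey; have : (E `&` O) y by rewrite EO.
  move=> [_ [U [oU mU] Uy]]; exists U; split; [exact: oU|exact: Uy|exact: mU].
apply: connE.
- exists y0; split=> //; exists B; last exact: By0.
  split; [exact: oB|exact: (minorized_local oB e00 kB)].
- by exists O.
- exists (closure (E `&` O)); first exact: closed_closure.
  apply/seteqP; split => [y [Ey Oy]|y [Ey cy]].
    by split=> //; apply: subset_closure.
  split=> //; have [U [e [oU Uy e1 kU]]] := k_loc Ey.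
  have [z [[Ez [V [oV mV Vz]]] Uz]] := cy U (open_nbhs_nbhs (conj oU Uy)).
  exists U => //; split=> //.
  by apply: (minorized_step oV mV oU e1 kU); exists z.
Qed.

(** Being minorized passes to finite unions, so the sets whose complement in
    [E] is covered by a minorized open set form a filter. If [E] itself were not
    covered, this filter would be proper and would cluster at a point of [E],
    against the local property. *)
Lemma minorized_compact (B : set Rn) :
  (forall y, E y -> exists U : set Rn, [/\ open U, U y & minorized B U]) ->
  exists U : set Rn, [/\ open U, E `<=` U & minorized B U].
Proof.
move=> Hloc; apply: contrapT => nU.
pose F : set_system Rn := [set S | exists U : set Rn,
  [/\ open U, E `\` S `<=` U & minorized B U]].
have FF : Filter F.
  split.
  - by exists set0; split; [exact: open0|move=> y [_ []]|exact: minorized0].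
  - move=> S1 S2 [U1 [op1 sb1 mi1]] [U2 [op2 sb2 mi2]]; exists (U1 `|` U2).
    split; [exact: openU| |exact: minorizedU].
    by move=> y [Ey] /not_andP[n1|n2]; [left; exact: sb1|right; exact: sb2].
  - move=> S1 S2 S12 [U [oU sU mU]]; exists U; split=> // y [Ey n2].
    by apply: sU; split=> // /S12.
have PF : ProperFilter F.
  split=> // -[U [oU sU mU]]; apply: nU; exists U; split=> // y Ey.
  by apply: sU; split=> // -[].
have FE : F E.
  by exists set0; split; [exact: open0|move=> y []|exact: minorized0].
have [p [Ep clp]] := cE PF FE.
have [U [oU Up mU]] := Hloc p Ep.
have FU : F (~` U) by exists U; split=> // y [_] /contrapT.
by have [q [nq Uq]] := clp _ _ FU (open_nbhs_nbhs (conj oU Up)).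
Qed.

Lemma local_degree_gt0 x : E x -> 0 < kernel_degree nu k x.
Proof.
move=> Ex; have [U [e [oU Ux e0 kU]]] := k_loc Ex.
have nU : 0 < fine (nu (U `&` E)).
  rewrite fine_gt0// ltey_eq fin_num_measure ?andbT; last exact: mUE.
  by apply: nu_gt0 => //; exists x.
apply: (lt_le_trans (mulr_gt0 e0 nU)).
have -> : fine (nu (U `&` E)) = \int[nu]_y \1_(U `&` E) y.
  by rewrite /Rintegral integral_indic ?setIT//; exact: mUE.
have bU : bfun (\1_(U `&` E) : Rn -> R) by apply/bfun_indic/mUE.
have bkx : bfun (k x).
  have := bfun_kernel_section JS x (bfun_cst Rn (1 : R)).
  by under eq_fun do rewrite mulr1.
rewrite -bintZ; [|exact: nufin|exact: bU].
apply: (le_bint nufin); [exact: bfunZ|exact: bkx|].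
move=> y; rewrite indicE; case: (boolP (_ \in _)) => [|_].
  by rewrite inE => -[Uy Ey]; rewrite mulr1; exact: kU.
by rewrite mulr0; exact: (jump_ge0 JS).
Qed.

Theorem doeblin_minorization : E !=set0 -> exists (B : set Rn) (m e : R),
  [/\ measurable B, (0 < nu B)%E, 0 < m, 0 < e &
    forall g, bfun g -> (forall y, 0 <= g y) -> forall x, B x ->
      e * \int[nu]_y g y <= T m g x].
Proof.
move=> [y0 Ey0]; have [B [oB By0 HB]] := minorized_point Ey0.
have [U [oU EU [m [e [e0 HU]]]]] := minorized_compact HB.
exists (B `&` E), (m%:R + 1), (expR (- (H * 1)) * e); split.
- exact: mUE.
- by apply: nu_gt0 => //; exists y0.
- by rewrite ltr_wpDl.
- by rewrite mulr_gt0// expR_gt0.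
move=> g bg g0 x Bx.
apply: le_trans (trans_ge_decay JS x bg g0 (ler0n _ m) ler01).
rewrite -mulrA ler_pM2l; last exact: expR_gt0.
apply: le_trans (HU g bg g0 x Bx); rewrite (ler_pM2l e0).
have -> : U `&` E = E by apply/setIidr.
have [_ [M gM]] := bg.
have bE : bfun (\1_E : Rn -> R) by exact: bfun_indic.
have bnE : bfun (\1_(~` E) : Rn -> R) by apply: bfun_indic; exact: measurableC.
rewrite -subr_le0 -bintB; [|exact: nufin|exact: bg|exact: bfunM].
apply: (@le_trans _ _ (\int[nu]_y (M * \1_(~` E) y))).
  apply: (le_bint nufin); [exact: bfunB bg (bfunM bg bE)|exact: bfunZ|].
  move=> y; rewrite !indicE in_setC; case: (y \in E) => /=.
    by rewrite mulr1 subrr mulr0.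
  by rewrite mulr0 subr0 mulr1; exact: le_trans (ler_norm _) (gM y).
rewrite bintZ; [|exact: nufin|exact: bnE].
have -> : \int[nu]_y \1_(~` E) y = 0 :> R.
  rewrite /Rintegral integral_indic; [|exact: measurableT|exact: measurableC].
  by rewrite setIT; exact: (congr1 fine nuE).
by rewrite mulr0.
Qed.

End minorization.

(** * The transition kernels of a Markov process *)

Section law.
Context (R : realType) d (T : measurableType d) d' (S : measurableType d').
Variables (E : set S) (P : S -> probability T R) (Y : R -> T -> S).
Hypotheses (mE : measurable E) (MP : markov_process E P Y).

Let max0 (t : R) : 0 <= Num.max t 0.
Proof. by rewrite le_max lexx orbT. Qed.

Let Ytime (t : R) : measurable_fun setT (Y (Num.max t 0)).
Proof. by have [mY _ _ _] := MP; have [] := mY _ (max0 t). Qed.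

Definition position (t : R) : {mfun T >-> S} := mfun_Sub (mem_set (Ytime t)).

(** Starting points outside [E] are frozen and negative times replaced by 0, so
    that these are kernels on the whole space for every real time; the semigroup
    property at nonnegative times survives because [E] is never left. *)
Definition law (t : R) (x : S) : {measure set S -> \bar R} :=
  if x \in E then distribution (P x) (position t) : {measure set S -> \bar R}
  else \d_x : {measure set S -> \bar R}.

Let positionE (t : R) : 0 <= t -> position t = Y t :> (T -> S).
Proof. by move=> t0; rewrite /position /= max_l. Qed.

Lemma lawE (t : R) x C : E x -> 0 <= t -> law t x C = P x (Y t @^-1` C).
Proof.
move=> Ex t0; rewrite /law mem_set//.
by rewrite -[LHS]/(P x (position t @^-1` C)) (positionE t0).
Qed.

Lemma law_notin (t : R) x C : ~ E x -> law t x C = \d_x C.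
Proof. by move=> Ex; rewrite /law memNset. Qed.

Let law_neg (t : R) x C : law t x C = law (Num.max t 0) x C.
Proof.
rewrite /law; case: ifP => // _.
rewrite -[LHS]/(P x (Y (Num.max t 0) @^-1` C)).
by rewrite -[RHS]/(P x (Y (Num.max (Num.max t 0) 0) @^-1` C)) (max_l (max0 t)).
Qed.

Let measurable_law (t : R) C : measurable C -> measurable_fun setT (law t ^~ C).
Proof.
move=> mC; have -> : (law t)^~ C = (law (Num.max t 0))^~ C.
  by apply/funext => x; exact: law_neg.
have t0 := max0 t.
rewrite -(setUv E); apply/measurable_funU => //; first exact: measurableC.
split.
  apply: (eq_measurable_fun (fun x => P x (Y (Num.max t 0) @^-1` C))).
    by move=> x; rewrite inE => Ex; rewrite lawE.
  by have [_ mP _ _] := MP; exact: mP.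
apply: (eq_measurable_fun (fun x => \d_x C)).
  by move=> x; rewrite inE => nEx; rewrite law_notin.
apply: (measurable_funS measurableT) => //; exact: measurable_fun_dirac.
Qed.

HB.instance Definition _ t :=
  isKernel.Build _ _ _ _ _ (law t) (@measurable_law t).

Let law_prob t x : law t x setT = 1%E.
Proof.
by rewrite /law; case: ifP => _; [exact: probability_setT|exact: diracT].
Qed.

HB.instance Definition _ t :=
  Kernel_isProbability.Build _ _ _ _ _ (law t) (law_prob t).

Definition law_kernel (t : R) : R.-pker S ~> S := law t.

Lemma law_kernelE (t : R) x C : E x -> 0 <= t ->
  law_kernel t x C = P x (Y t @^-1` C).
Proof. exact: lawE. Qed.

Lemma law_kernel_chapman_kolmogorov (s t : R) x C : 0 <= s -> 0 <= t ->
  measurable C ->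
  law_kernel (s + t) x C = (\int[law_kernel s x]_y law_kernel t y C)%E.
Proof.
move=> s0 t0 mC; have [Ex|nEx] := pselect (E x); last first.
  rewrite (eq_measure_integral \d_x); last by move=> A mA _; exact: law_notin.
  rewrite integral_dirac//; last exact: (measurable_kernel (law_kernel t) _ mC).
  by rewrite diracT mul1e [LHS]law_notin// [RHS]law_notin.
rewrite law_kernelE ?addr_ge0//.
have [mY _ _ mark] := MP.
have pT : past Y s [set: T].
  apply: sub_sigma_algebra; exists s, setT; rewrite lexx s0.
  by split => //; rewrite preimage_setT.
have := mark x s t setT C Ex s0 t0 pT mC; rewrite setTI => ->.
rewrite (eq_measure_integral (distribution (P x) (position s))); last first.
  by move=> A mA _; rewrite /= /law mem_set.
rewrite ge0_integral_distribution//; last first.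
  exact: (measurable_kernel (law_kernel t) _ mC).
apply: eq_integral => w _.
have EYw : E (Y s w) by have [_] := mY s s0; apply; exists w.
have YE : position s w = Y s w by rewrite (positionE s0).
by rewrite -(law_kernelE C EYw t0) -YE.
Qed.

Lemma integral_law_kernel (t : R) x (g : S -> \bar R) : E x -> 0 <= t ->
  measurable_fun setT g -> (law_kernel t x).-integrable setT g ->
  (P x).-integrable setT (g \o Y t) /\
  (\int[law_kernel t x]_y g y = \int[P x]_w g (Y t w))%E.
Proof.
move=> Ex t0 mg ig.
have dE : forall f : S -> \bar R, (\int[law_kernel t x]_y f y =
    \int[distribution (P x) (position t)]_y f y)%E.
  move=> f; apply: eq_measure_integral => A mA _.
  by rewrite /= /law mem_set.
have mY : measurable_fun setT (Y t).
  by have [mY _ _ _] := MP; have [] := mY t t0.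
have igY : (P x).-integrable setT (g \o Y t).
  apply/integrableP; split; first exact: measurableT_comp.
  have [_] := integrableP _ _ _ ig.
  rewrite dE ge0_integral_distribution//; last first.
    exact: measurableT_comp.
  by rewrite positionE.
split=> //; rewrite dE.
have mp : measurable_fun setT (position t) by rewrite positionE.
have ig' : (P x).-integrable (position t @^-1` setT) (g \o position t).
  by rewrite preimage_setT positionE.
rewrite [LHS](integral_pushforward mp mg ig' measurableT).
by rewrite preimage_setT positionE.
Qed.

End law.

(** * Lebesgue measure and topology *)

Section Rn_topology.
Context (R : realType) (N : nat).
Notation Rn := (Rn R N).

Lemma closed_measurable_Rn (A : set Rn) : closed A -> measurable A.
Proof.
move=> cA; rewrite -(setCK A); apply: measurableC.
by apply: open_measurable_Rn; exact: closed_openC.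
Qed.

Definition box (a b : 'I_N -> R) : set Rn :=
  [set x | forall i, a i <= (x : 'rV_N) ord0 i <= b i].

Lemma measurable_box a b : measurable (box a b).
Proof.
apply: closed_measurable_Rn.
rewrite (_ : box a b = \bigcap_(i in [set: 'I_N])
    ((fun x : 'rV[R]_N => x ord0 i) @^-1` `[a i, b i])).
  apply: closed_bigI => i _; apply: preimage_closed; last exact: itv_closed.
  by move=> x _; exact: coord_continuous.
apply/seteqP; split => t /=.
  by move=> xt i _; rewrite /= in_itv /=; exact: xt.
by move=> xt i; have := xt i I; rewrite /= in_itv.
Qed.

Lemma lebesgue_bounded_lty (A : set Rn) : measurable A -> bounded_set A ->
  (lebesgue A < +oo)%E.
Proof.
move=> mA [M [_ HM]]; pose M1 := `|M| + 1.
have AM x : A x -> `|x| <= M1.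
  by move=> Ax; apply: HM Ax; rewrite (le_lt_trans (ler_norm M))// ltrDl.
apply: (@le_lt_trans _ _ (lebesgue (box (fun=> - M1) (fun=> M1)))).
  apply: le_measure; rewrite ?inE//; first exact: measurable_box.
  move=> x Ax i; rewrite -ler_norml; apply: le_trans (AM x Ax).
  rewrite [leRHS]mx_normrE.
  exact: (le_bigmax _ (fun ij => `|(x : 'rV_N) ij.1 ij.2|) (ord0, i)).
rewrite /box lebesgue_box ?ltry// => i.
have : 0 <= `|M| by []. rewrite /M1; lra.
Qed.

Lemma lebesgue_open_gt0 (U : set Rn) : open U -> U !=set0 ->
  (0 < lebesgue U)%E.
Proof.
move=> oU [x Ux].
have /nbhs_ballP[e /= e0 eU] : nbhs x U by exact: open_nbhs_nbhs.
pose a i := (x : 'rV_N) ord0 i - e / 2; pose b i := (x : 'rV_N) ord0 i + e / 2.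
apply: (@lt_le_trans _ _ (lebesgue (box a b))).
  rewrite /box lebesgue_box; last by move=> i; rewrite /a /b; lra.
  by rewrite lte_fin prodr_gt0// => i _; rewrite /a /b; lra.
apply: le_measure; rewrite ?inE.
- exact: measurable_box.
- exact: open_measurable_Rn.
move=> y yab; apply: eU; split => // i j; rewrite ord1.
have := yab j; rewrite /a /b /ball/= /ball_ => yj.
rewrite ltr_norml; lra.
Qed.

(** Balls with rational centre and radius [1 / (n + 1)] form a countable
    base. *)
Lemma rational_ball_in (U : set Rn) (x : Rn) : nbhs x U ->
  exists q : 'rV[rat]_N * nat,
    ball (map_mx ratr q.1 : Rn) q.2.+1%:R^-1 x /\
    ball (map_mx ratr q.1 : Rn) q.2.+1%:R^-1 `<=` U.
Proof.
move=> /nbhs_ballP[e /= e0 eU].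
have [k ke] : exists k : nat, (k.+1%:R^-1 : R) < e / 2.
  exists (Num.truncn (e / 2)^-1).
  by rewrite invf_plt ?posrE ?divr_gt0// truncnS_gt.
have k0 : 0 < (k.+1%:R^-1 : R) by rewrite invr_gt0.
have /choice[q xq] (i : 'I_N) : exists q : rat,
    ball ((x : 'rV[R]_N) ord0 i) k.+1%:R^-1 (ratr q).
  have [y [yb [q _ qy]]] := @dense_rat R _ (ex_intro _ _ (ballxx
    ((x : 'rV[R]_N) ord0 i) k0)) (ball_open _ _).
  by exists q; rewrite qy.
have xq' : ball (map_mx ratr (\row_i q i) : Rn) k.+1%:R^-1 x.
  split=> // i j; rewrite ord1 !mxE; apply: ball_sym; exact: xq.
exists (\row_i q i, k); split => // y qy; apply: eU.
apply: (@le_ball _ _ _ (k.+1%:R^-1 + k.+1%:R^-1)).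
  by rewrite [leRHS]splitr lerD// ltW.
exact: ball_triangle (ball_sym xq') qy.
Qed.

(** Open sets of the product are countable unions of products of basic balls. *)
Lemma open_measurable_prod (U : set (Rn * Rn)) : open U -> measurable U.
Proof.
move=> oU.
pose I : Type := (('rV[rat]_N * nat) * ('rV[rat]_N * nat))%type.
pose D (q : 'rV[rat]_N * nat) : set Rn :=
  ball (map_mx ratr q.1 : Rn) q.2.+1%:R^-1.
have mD q : measurable (D q).
  by apply: open_measurable_Rn; apply: ball_open; rewrite invr_gt0.
rewrite (_ : U = \bigcup_(q in [set q : I | D q.1 `*` D q.2 `<=` U])
    (D q.1 `*` D q.2)); last first.
  apply/seteqP; split => [[x y] Uxy|z [q /= qU]]; last exact: qU.
  have [[V W] /= [Vx Wy] VW] : nbhs (x, y) U by exact: open_nbhs_nbhs.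
  have [q1 [q1x q1V]] := rational_ball_in Vx.
  have [q2 [q2y q2W]] := rational_ball_in Wy.
  exists (q1, q2) => //= z [z1 z2]; apply: VW.
  by split; [exact: q1V|exact: q2W].
rewrite bigcup_mkcond; apply: countable_bigcupT_measurable => [|q].
  exact: countableP.
by case: ifP => // _; apply: measurableX.
Qed.

Lemma continuous_measurable_prod (f : Rn -> Rn -> R) :
  continuous (fun z : Rn * Rn => f z.1 z.2) ->
  measurable_fun setT (fun z : Rn * Rn => f z.1 z.2).
Proof.
move=> cf; apply: (measurability _ (RGenOpens.measurableE R)).
move=> _ [_ [a [b ->] <-]]; rewrite setTI.
apply: open_measurable_prod; apply: open_comp; last exact: interval_open.
by move=> z _; exact: cf.
Qed.

End Rn_topology.

(** * Integration against a restricted measure *)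

Section restriction.
Context d (X : measurableType d) (R : realType).
Variable mu : {measure set X -> \bar R}.
Variables (D : set X) (mD : measurable D) (Dfin : (mu D < +oo)%E).
Local Notation nu := (mfrestr mD Dfin).

Lemma integral_mfrestr (f : X -> \bar R) : measurable_fun setT f ->
  (\int[nu]_x f x = \int[mu]_(x in D) f x)%E.
Proof.
move=> mf; have mDC : measurable (~` D) by exact: measurableC.
have nuDC : nu (~` D) = 0%E.
  by rewrite /mfrestr /mrestr/= setICl measure0.
have nuD (g : X -> \bar R) : measurable_fun setT g -> (forall x, 0 <= g x)%E ->
    (\int[nu]_x g x = \int[mu]_(x in D) g x)%E.
  move=> mg g0; have -> : (\int[nu]_x g x = \int[nu]_(x in D) g x)%E.
    rewrite (ge0_negligible_integral mDC measurableT mg (fun x _ => g0 x) nuDC).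
    by rewrite setTD setCK.
  apply: eq_measure_integral => A mA AD.
  by rewrite /mfrestr /mrestr/=; congr (mu _); apply/setIidl.
rewrite [LHS]integralE [RHS]integralE; congr (_ - _)%E; apply: nuD => //.
- exact: measurable_funepos.
- exact: measurable_funeneg.
Qed.

Lemma Rintegral_mfrestr (f : X -> R) : measurable_fun setT f ->
  \int[nu]_x f x = \int[mu]_(x in D) f x.
Proof.
by move=> mf; congr fine; apply: integral_mfrestr; exact/measurable_EFinP.
Qed.

(** [2 |f| <= 1 + f ^ 2], and [D] has finite measure. *)
Lemma Lfun2_integrable_mfrestr (f : X -> R) : measurable_fun setT f ->
  (f \_ D : X -> R) \in Lfun mu 2%:E -> nu.-integrable setT (EFin \o f).
Proof.
move=> mf f2.
have mnf : measurable_fun setT (fun x => `|f x|%:E).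
  by apply/measurable_EFinP; exact: measurableT_comp.
apply/integrableP; split; first exact/measurable_EFinP.
rewrite (integral_mfrestr mnf).
have isq := integrableS measurableT mD (@subsetT _ _) (Lfun2_integrable_sqr f2).
have i1 : mu.-integrable D (EFin \o (fun _ : X => 1 : R)).
  apply: measurable_bounded_integrable => //; exists 1.
  by split; [exact: num_real|move=> M M1 y _ /=; rewrite normr1 ltW].
have [ms lts] := integrableP _ _ _ (integrableD mD i1 isq).
apply: le_lt_trans lts; apply: ge0_le_integral => //.
- exact: measurable_funS mnf.
- exact: measurableT_comp.
move=> y Dy; rewrite /= patchE (mem_set Dy) lee_fin.
rewrite [leRHS]ger0_norm; last by rewrite addr_ge0// sqr_ge0.
have := sqr_ge0 (`|f y| - 1); rewrite sqrrB1 real_normK ?num_real//.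
by have := normr_ge0 (f y); have := sqr_ge0 (f y); lra.
Qed.

End restriction.

(** * The kernel patched from J, G and K *)

Section jump_kernel.
Context d (X : measurableType d) (R : realType).
Variable mu : {measure set X -> \bar R}.
Variables (D : set X) (mD : measurable D) (Dfin : (mu D < +oo)%E).
Local Notation nu := (mfrestr mD Dfin).
Variables (E A B : set X) (J G K : X -> X -> R).

Definition patch_kernel (S S' : set X) (V : X -> X -> R) x y :=
  \1_S x * \1_S' y * V x y.

Definition jump_kernel x y := patch_kernel A A J x y + patch_kernel B B G x y +
  patch_kernel A B K x y + patch_kernel B A K x y.

Section patch.
Variables (S S' : set X) (V : X -> X -> R) (c : R).
Hypotheses (mS : measurable S) (mS' : measurable S')
  (SE : S `<=` E) (S'E : S' `<=` E)
  (mV : measurable_fun setT (fun z : X * X => V z.1 z.2))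
  (V0 : forall x y, 0 <= V x y)
  (c0 : 0 <= c) (Vc : forall x y, E x -> E y -> V x y <= c).

Lemma measurable_patch_kernel :
  measurable_fun setT (fun z : X * X => patch_kernel S S' V z.1 z.2).
Proof.
apply: measurable_funM => //; apply: measurable_funM.
  exact: (bfun_comp_fst (bfun_indic R mS)).1.
exact: (bfun_comp_snd (bfun_indic R mS')).1.
Qed.

Lemma patch_kernel_ge0 x y : 0 <= patch_kernel S S' V x y.
Proof. by rewrite /patch_kernel !mulr_ge0. Qed.

Lemma patch_kernel_le x y : patch_kernel S S' V x y <= c.
Proof.
rewrite /patch_kernel !indicE.
case: (boolP (x \in S)) => [|_]; last by rewrite !mul0r.
case: (boolP (y \in S')) => [|_]; last by rewrite mulr0 mul0r.
by rewrite !inE !mul1r => yS xS; apply: Vc; [exact: SE|exact: S'E].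
Qed.

Lemma patch_kernel_integrable w x : nu.-integrable setT (EFin \o w) ->
  nu.-integrable setT (EFin \o (fun y => patch_kernel S S' V x y * w y)).
Proof.
move=> iw; have iwc : nu.-integrable setT (fun y => (c * w y)%:E).
  by under eq_fun do rewrite EFinM; exact: integrableZl.
have [/measurable_EFinP mw _] := integrableP _ _ _ iw.
apply: le_integrable iwc => //.
  apply/measurable_EFinP; apply: measurable_funM => //.
  exact: (measurableT_comp measurable_patch_kernel (measurable_pair1 x)).
move=> y _; rewrite lee_fin !normrM ler_wpM2r// !ger0_norm//.
  exact: patch_kernel_le.
Qed.

Lemma Rintegral_patch_kernel w x : measurable_fun setT w ->
  \int[nu]_y (patch_kernel S S' V x y * w y) =
  \1_S x * \int[mu]_(y in D) (\1_S' y * V x y * w y).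
Proof.
move=> mw; have mh : measurable_fun setT (fun y => \1_S' y * V x y * w y).
  apply: measurable_funM => //; apply: measurable_funM => //.
  exact: (measurableT_comp mV (measurable_pair1 x)).
rewrite -(Rintegral_mfrestr mD Dfin mh) indicE /patch_kernel.
case: (boolP (x \in S)) => xS /=.
  by rewrite mul1r; apply: eq_Rintegral => y _; rewrite indicE xS mul1r.
rewrite mul0r; under eq_Rintegral do rewrite indicE (negbTE xS) !mul0r.
by rewrite Rintegral_cst// mul0r.
Qed.

End patch.

Hypotheses (mA : measurable A) (mB : measurable B)
  (AE : A `<=` E) (BE : B `<=` E)
  (mJ : measurable_fun setT (fun z : X * X => J z.1 z.2))
  (mG : measurable_fun setT (fun z : X * X => G z.1 z.2))
  (mK : measurable_fun setT (fun z : X * X => K z.1 z.2))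
  (J0 : forall x y, 0 <= J x y) (G0 : forall x y, 0 <= G x y)
  (K0 : forall x y, 0 <= K x y)
  (Js : forall x y, J x y = J y x) (Gs : forall x y, G x y = G y x)
  (Ks : forall x y, K x y = K y x).
Variables (c : R).
Hypotheses (c0 : 0 <= c) (Jc : forall x y, E x -> E y -> J x y <= c)
  (Gc : forall x y, E x -> E y -> G x y <= c)
  (Kc : forall x y, E x -> E y -> K x y <= c).

Lemma measurable_jump_kernel :
  measurable_fun setT (fun z : X * X => jump_kernel z.1 z.2).
Proof.
by do 3 (apply: measurable_funD; last exact: measurable_patch_kernel);
  exact: measurable_patch_kernel.
Qed.

Lemma jump_kernel_ge0 x y : 0 <= jump_kernel x y.
Proof. by rewrite !addr_ge0// patch_kernel_ge0. Qed.

Lemma jump_kernel_le x y : jump_kernel x y <= c + c + c + c.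
Proof. by rewrite !lerD//; exact: patch_kernel_le. Qed.

Lemma jump_kernel_sym x y : jump_kernel x y = jump_kernel y x.
Proof. by rewrite /jump_kernel /patch_kernel Js Gs Ks; ring. Qed.

Lemma Rintegral_jump_kernel w x : nu.-integrable setT (EFin \o w) ->
  \int[nu]_y (jump_kernel x y * w y) =
    \1_A x * \int[mu]_(y in D) (\1_A y * J x y * w y)
  + \1_B x * \int[mu]_(y in D) (\1_B y * G x y * w y)
  + \1_A x * \int[mu]_(y in D) (\1_B y * K x y * w y)
  + \1_B x * \int[mu]_(y in D) (\1_A y * K x y * w y).
Proof.
move=> iw; have [/measurable_EFinP mw _] := integrableP _ _ _ iw.
rewrite -!Rintegral_patch_kernel//.
have i1 := patch_kernel_integrable mA mA AE AE mJ J0 c0 Jc x iw.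
have i2 := patch_kernel_integrable mB mB BE BE mG G0 c0 Gc x iw.
have i3 := patch_kernel_integrable mA mB AE BE mK K0 c0 Kc x iw.
have i4 := patch_kernel_integrable mB mA BE AE mK K0 c0 Kc x iw.
have i12 := integrableD measurableT i1 i2.
have i123 := integrableD measurableT i12 i3.
rewrite -(RintegralD measurableT i1 i2) -(RintegralD measurableT i12 i3).
rewrite -(RintegralD measurableT i123 i4).
by apply: eq_Rintegral => y _; rewrite /jump_kernel; ring.
Qed.

(** Whatever the sides of [x] and [y], exactly one of the four patches is
    active, so that the kernel is at least the minimum of [J], [G] and [K]. *)
Lemma jump_kernel_lower (e : R) x y : A `|` B = E ->
  E x -> E y -> e <= J x y -> e <= G x y -> e <= K x y ->
  A `&` B = set0 -> e <= jump_kernel x y.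
Proof.
move=> ABE Ex Ey eJ eG eK AB0.
have inAB z : E z -> (z \in A) = ~~ (z \in B).
  rewrite -ABE => -[Az|Bz].
    rewrite mem_set// memNset// => Bz.
    by have : (A `&` B) z by []; rewrite AB0.
  rewrite (mem_set Bz) memNset// => Az.
  by have : (A `&` B) z by []; rewrite AB0.
rewrite /jump_kernel /patch_kernel !indicE !inAB//.
by case: (x \in B); case: (y \in B) => /=; lra.
Qed.

End jump_kernel.

(** * The generator on bounded functions *)

Section generator.
Context (R : realType) d (T : measurableType d) d' (S : measurableType d').
Variables (E : set S) (P : S -> probability T R) (Y : R -> T -> S).
Hypotheses (mE : measurable E) (MP : markov_process E P Y).

Local Notation kappa := (law_kernel mE MP).

Lemma trans_law (t : R) x (g : S -> R) : E x -> 0 <= t -> bfun g ->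
  trans kappa t g x = fine ('E_(P x)[g \o Y t])%E.
Proof.
move=> Ex t0 bg; rewrite /trans /Rintegral unlock; congr fine.
have kfin : (kappa t x setT < +oo)%E by rewrite prob_kernel ltry.
have mg : measurable_fun setT (EFin \o g).
  by apply/measurable_EFinP; exact: bg.1.
by have [_ ->] := integral_law_kernel Ex t0 mg (bfun_integrable kfin bg).
Qed.

Lemma trans_law_notin (t : R) x (g : S -> R) : ~ E x -> bfun g ->
  trans kappa t g x = g x.
Proof.
move=> nEx bg; rewrite /trans /Rintegral (eq_measure_integral \d_x); last first.
  by move=> C mC _; exact: law_notin.
rewrite integral_dirac//; last by apply/measurable_EFinP; exact: bg.1.
by rewrite diracT mul1e.
Qed.

Lemma trans_law_generator (L : (S -> R) -> S -> R) (g : S -> R) :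
  has_bounded_generator E P Y L -> bfun g -> forall e : R, 0 < e ->
  exists2 del : R, 0 < del & forall (h : R) x, 0 < h -> h < del -> E x ->
    `|trans kappa h g x - g x - h * L g x| <= h * e.
Proof.
move=> HL bg e e0; have [mg [M gM]] := bg.
have bE : [bounded g x | x in E].
  exists M; split; first exact: num_real.
  by move=> z Mz x _ /=; apply: le_trans (gM x) (ltW Mz).
have mgE : measurable_fun E g by apply: measurable_funS mg.
have := HL g mgE bE.
move=> /(_ [set f | forall y, E y -> `|L g y - f y| < e]) /=.
case.
  apply/uniform_nbhs; exists [set xy | ball xy.1 e xy.2].
  split; first exact: (entourage_ball _ (PosNum e0)).
  by move=> f Hf y Ey; exact: Hf.
move=> del /= del0 Hdel; exists del => // h x h0 hd Ex.
have : ball_ Num.Def.normr 0 del h by rewrite /ball_ /= sub0r normrN gtr0_norm.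
move=> /Hdel /(_ h0 x Ex); rewrite -trans_law// ?(ltW h0)// distrC => hh.
have -> : trans kappa h g x - g x - h * L g x =
    h * ((trans kappa h g x - g x) / h - L g x).
  by field; rewrite gt_eqF.
by rewrite normrM (gtr0_norm h0) ler_pM2l// ltW.
Qed.

End generator.

(** * The nonlocal problem on a bounded domain *)

Section domain.
Context (R : realType) (N : nat).
Notation Rn := (Rn R N).
Implicit Types (Omega : set Rn) (V : Rn -> Rn -> R).

Lemma bounded_set_closure Omega :
  bounded_set Omega -> bounded_set (closure Omega).
Proof.
move=> [M [_ HM]]; pose M1 := `|M| + 1.
have OM : Omega `<=` closed_ball_ Num.Def.normr (0 : Rn) M1.
  move=> x Ox; rewrite /closed_ball_ /= sub0r normrN.
  by apply: HM Ox; rewrite (le_lt_trans (ler_norm M))// ltrDl.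
have : closure Omega `<=` closed_ball_ Num.Def.normr (0 : Rn) M1.
  apply: (subset_trans (closure_subset OM)).
  by rewrite -(closure_id _).1//; exact: closed_closed_ball_.
move=> H; exists M1; split; first exact: num_real.
move=> z Mz x /H; rewrite /closed_ball_ /= sub0r normrN => /le_trans; apply.
exact: ltW.
Qed.

Lemma compact_closure_bounded Omega :
  bounded_set Omega -> compact (closure Omega).
Proof.
move=> bO; apply: (@bounded_closed_compact R N).
  exact: bounded_set_closure.
exact: closed_closure.
Qed.

Lemma kernel_bounded (E : set Rn) V : compact E ->
  continuous (fun z : Rn * Rn => V z.1 z.2) ->
  exists2 c : R, 0 <= c & forall x y, E x -> E y -> V x y <= c.
Proof.
move=> cE cV.
have cVE : compact [set V z.1 z.2 | z in E `*` E].
  apply: (@continuous_compact _ _ (fun z : Rn * Rn => V z.1 z.2)).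
    exact: continuous_subspaceT.
  exact: compact_setX.
have [M [_ HM]] := compact_bounded cVE.
exists (`|M| + 1); first by rewrite addr_ge0.
move=> x y Ex Ey; apply: le_trans (ler_norm _) _.
apply: (HM (`|M| + 1)); first by rewrite (le_lt_trans (ler_norm M))// ltrDl.
by exists (x, y).
Qed.

Lemma kernel_locally_pos V y : continuous (fun z : Rn * Rn => V z.1 z.2) ->
  0 < V y y -> exists2 U : set Rn, open U /\ U y &
    forall x z, U x -> U z -> V y y / 2 <= V x z.
Proof.
move=> cV Vy.
have : \forall z \near ((y, y) : Rn * Rn), V y y / 2 < V z.1 z.2.
  have lt2 : V y y / 2 < V y y by rewrite ltr_pdivrMr// ltr_pMr// ltr1n.
  exact: (cvgr_gt (V y y) (cV (y, y)) _ lt2).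
move=> [[U1 U2] /= [nU1 nU2] H].
exists (interior (U1 `&` U2)).
  split; first exact: open_interior.
  by apply: filterI.
move=> x z /interior_subset[U1x _] /interior_subset[_ U2z].
by apply/ltW; apply: (H (x, z)).
Qed.

End domain.

Section nonlocal_domain.
Context (R : realType) (N : nat).
Notation Rn := (Rn R N).
Variables (Omega A B : set Rn) (J G K : Rn -> Rn -> R).
Hypotheses (oO : open Omega) (bO : bounded_set Omega)
  (kJ : nonlocal_kernel Omega J) (kG : nonlocal_kernel Omega G)
  (kK : nonlocal_kernel Omega K)
  (mA : measurable A) (mB : measurable B) (AB0 : A `&` B = set0)
  (ABE : A `|` B = closure Omega).

Local Notation E := (closure Omega).

Let mO : measurable Omega. Proof. exact: open_measurable_Rn. Qed.

Let Ofin : (lebesgue Omega < +oo)%E.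
Proof. exact: lebesgue_bounded_lty. Qed.

Let OE : Omega `<=` E. Proof. exact: subset_closure. Qed.
Let AE : A `<=` E. Proof. by rewrite -ABE; left. Qed.
Let BE : B `<=` E. Proof. by rewrite -ABE; right. Qed.

Definition domain_measure : {finite_measure set Rn -> \bar R} :=
  mfrestr mO Ofin.

Local Notation nu := (mfrestr mO Ofin).
Local Notation k := (jump_kernel A B J G K).

Lemma measurable_closure : measurable E.
Proof. by apply: closed_measurable_Rn; exact: closed_closure. Qed.

Let mkernel V : nonlocal_kernel Omega V ->
  measurable_fun setT (fun z : Rn * Rn => V z.1 z.2).
Proof. by move=> [cV _ _ _ _]; exact: continuous_measurable_prod. Qed.

Lemma kernel_bound : exists2 c : R, 0 <= c &
  [/\ forall x y, E x -> E y -> J x y <= c,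
      forall x y, E x -> E y -> G x y <= c &
      forall x y, E x -> E y -> K x y <= c].
Proof.
have cE : compact E by exact: compact_closure_bounded.
have [cJ _ _ _ _] := kJ; have [cG _ _ _ _] := kG; have [cK _ _ _ _] := kK.
have [a a0 Ha] := kernel_bounded cE cJ.
have [b b0 Hb] := kernel_bounded cE cG.
have [e e0 He] := kernel_bounded cE cK.
exists (a + b + e); first by rewrite !addr_ge0.
split=> x y Ex Ey.
- by have := Ha x y Ex Ey; lra.
- by have := Hb x y Ex Ey; lra.
- by have := He x y Ex Ey; lra.
Qed.

Lemma domain_measure_gt0 (U : set Rn) : open U -> U `&` E !=set0 ->
  (0 < nu (U `&` E))%E.
Proof.
move=> oU [x [Ux Ex]].
have [y [Oy Uy]] := Ex U (open_nbhs_nbhs (conj oU Ux)).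
have oUO : open (U `&` Omega) by exact: openI.
apply: (@lt_le_trans _ _ (lebesgue (U `&` Omega))).
  by apply: lebesgue_open_gt0 => //; exists y.
rewrite /mfrestr /mrestr; apply: le_measure; rewrite ?inE.
- exact: open_measurable_Rn.
- apply: measurableI => //; apply: measurableI; last exact: measurable_closure.
  exact: open_measurable_Rn.
- by move=> z [Uz Oz]; split=> //; split=> //; exact: OE.
Qed.

Lemma domain_measureC : nu (~` E) = 0%E.
Proof.
rewrite /mfrestr /mrestr (_ : ~` E `&` Omega = set0) ?measure0//.
by apply/seteqP; split => // x [nEx /OE].
Qed.

Lemma jump_kernel_local y : E y -> exists U : set Rn, exists e : R,
  [/\ open U, U y, 0 < e & forall x z, U x -> E x -> U z -> E z -> e <= k x z].
Proof.
move=> Ey.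
have [cJ _ pJ _ _] := kJ; have [cG _ pG _ _] := kG; have [cK _ pK _ _] := kK.
have [U1 [oU1 U1y] H1] := kernel_locally_pos cJ (pJ y).
have [U2 [oU2 U2y] H2] := kernel_locally_pos cG (pG y).
have [U3 [oU3 U3y] H3] := kernel_locally_pos cK (pK y).
pose e := Num.min (J y y / 2) (Num.min (G y y / 2) (K y y / 2)).
exists (U1 `&` U2 `&` U3), e; split.
- by apply: openI => //; exact: openI.
- by [].
- by rewrite !lt_min !divr_gt0.
move=> x z [[U1x U2x] U3x] Ex [[U1z U2z] U3z] Ez.
apply: (jump_kernel_lower ABE Ex Ez _ _ _ AB0).
- by apply: le_trans (H1 x z U1x U1z); rewrite ge_min lexx.
- by apply: le_trans (H2 x z U2x U2z); rewrite !ge_min lexx orbT.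
- by apply: le_trans (H3 x z U3x U3z); rewrite !ge_min lexx !orbT.
Qed.

Lemma jump_kernel_integralE w x : nu.-integrable setT (EFin \o w) ->
  \int[nu]_y (k x y * w y) =
    \1_A x * \int[lebesgue]_(y in Omega) (\1_A y * J x y * w y)
  + \1_B x * \int[lebesgue]_(y in Omega) (\1_B y * G x y * w y)
  + \1_A x * \int[lebesgue]_(y in Omega) (\1_B y * K x y * w y)
  + \1_B x * \int[lebesgue]_(y in Omega) (\1_A y * K x y * w y).
Proof.
move=> iw; have [c c0 [Jc Gc Kc]] := kernel_bound.
have [_ J0 _ _ _] := kJ; have [_ G0 _ _ _] := kG; have [_ K0 _ _ _] := kK.
exact: (Rintegral_jump_kernel mA mB AE BE (mkernel kJ) (mkernel kG)
  (mkernel kK) J0 G0 K0 c0 Jc Gc Kc x iw).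
Qed.

Lemma jump_generatorE g x : bfun g ->
  jump_generator Omega A B J G K g x = jump_op nu k g x.
Proof.
move=> bg; rewrite /jump_op jump_kernel_integralE//.
apply: bfun_integrable; last by apply: bfunB bg _; exact: bfun_cst.
by rewrite -ge0_fin_numE// fin_num_measure.
Qed.

Lemma neumann_operatorE u x : E x -> nu.-integrable setT (EFin \o (u \_ E)) ->
  neumann_operator Omega A B J G K u x = jump_op nu k (u \_ E) x.
Proof.
move=> Ex iu; rewrite /jump_op jump_kernel_integralE; last first.
  have ic : nu.-integrable setT (EFin \o (fun _ : Rn => (u \_ E) x)).
    apply: bfun_integrable; last exact: bfun_cst.
    by rewrite -ge0_fin_numE// fin_num_measure.
  exact: (integrableB measurableT iu ic).
have key (S : set Rn) (V : Rn -> Rn -> R) :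
    \int[lebesgue]_(y in S `&` Omega) (V x y * (u y - u x)) =
    \int[lebesgue]_(y in Omega) (\1_S y * V x y * ((u \_ E) y - (u \_ E) x)).
  rewrite Rintegral_mkcondl; apply: eq_Rintegral => y; rewrite inE => Oy.
  rewrite !patchE (mem_set Ex) (mem_set (OE Oy)) indicE.
  by case: (_ \in _); rewrite ?mul1r ?mul0r.
by rewrite /neumann_operator !key; ring.
Qed.

Lemma zero_mean_L2_integrable u : measurable_fun E u -> zero_mean_L2 Omega u ->
  nu.-integrable setT (EFin \o (u \_ E)) /\ \int[nu]_y (u \_ E) y = 0.
Proof.
move=> mu_ [u2 u0].
have mu' : measurable_fun setT (u \_ E).
  by apply/(measurable_restrictT _ measurable_closure).
have eqO : {in Omega, u \_ E =1 u}.
  by move=> y; rewrite inE => Oy; rewrite patchE (mem_set (OE Oy)).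
split; last by rewrite (Rintegral_mfrestr mO Ofin mu') (eq_Rintegral _ eqO).
apply: (Lfun2_integrable_mfrestr mO Ofin mu').
rewrite (_ : (u \_ E) \_ Omega = u \_ Omega)//.
apply/funext => y; rewrite !patchE; case: ifPn => // yO.
by rewrite ifT// inE; apply: OE; rewrite inE in yO.
Qed.

Section process.
Context d (T : measurableType d) (P : Rn -> probability T R) (Y : R -> T -> Rn).
Hypotheses (MP : markov_process E P Y)
  (gen : has_bounded_generator E P Y (jump_generator Omega A B J G K)).

Local Notation kappa := (law_kernel measurable_closure MP).

Lemma domain_jump_semigroup : exists c, jump_semigroup nu k kappa c.
Proof.
have [c c0 [Jc Gc Kc]] := kernel_bound; exists (c + c + c + c).
have [_ J0 _ Js _] := kJ; have [_ G0 _ Gs _] := kG; have [_ K0 _ Ks _] := kK.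
split.
- exact: (measurable_jump_kernel mA mB (mkernel kJ) (mkernel kG) (mkernel kK)).
- exact: jump_kernel_ge0.
- exact: (jump_kernel_le AE BE c0 Jc Gc Kc).
- exact: jump_kernel_sym.
- by move=> s t x C s0 t0 mC; exact: law_kernel_chapman_kolmogorov.
move=> g bg e e0.
have [del del0 Hdel] := trans_law_generator measurable_closure MP gen bg e0.
exists del => // h x h0 hd; have [Ex|nEx] := pselect (E x).
  by rewrite -jump_generatorE//; exact: Hdel.
rewrite trans_law_notin// subrr sub0r.
have -> : jump_op nu k g x = 0.
  rewrite -jump_generatorE// /jump_generator !indicE !memNset ?mul0r ?addr0//.
    by move=> /BE.
  by move=> /AE.
by rewrite mulr0 normrN normr0 mulr_ge0// ltW.
Qed.

End process.
End nonlocal_domain.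

Theorem lemma3p1 (R : realType) (N : nat) (Omega : set (Rn R N))
    (J G K : Rn R N -> Rn R N -> R) (A B : nat -> set (Rn R N))
    (n : nat) (f u : Rn R N -> R)
    (d : measure_display) (T : measurableType d)
    (P : Rn R N -> probability T R) (Y : R -> T -> Rn R N) :
  (0 < N)%N ->
  open Omega -> connected Omega -> bounded_set Omega ->
  nonlocal_kernel Omega J -> nonlocal_kernel Omega G ->
  nonlocal_kernel Omega K ->
  (forall m, (1 <= m)%N ->
    [/\ measurable (A m), measurable (B m), A m `&` B m = set0 &
        A m `|` B m = closure Omega]) ->
  (1 <= n)%N ->
  markov_process (closure Omega) P Y ->
  pure_jump (closure Omega) P Y ->
  has_bounded_generator (closure Omega) P Y
    (jump_generator Omega (A n) (B n) J G K) ->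
  measurable_fun (closure Omega) f -> zero_mean_L2 Omega f ->
  measurable_fun (closure Omega) u -> zero_mean_L2 Omega u ->
  (forall x, closure Omega x ->
    f x = neumann_operator Omega (A n) (B n) J G K u x) ->
  forall x, closure Omega x ->
    [/\ forall t, 0 <= t -> (P x).-integrable setT (EFin \o (f \o Y t)),
        lebesgue_measure.-integrable `[(0 : R)%R, +oo[ (fun t => 'E_(P x)[f \o Y t])%E &
        (u x)%:E =
        (- \int[lebesgue_measure]_(t in `[(0 : R)%R, +oo[) 'E_(P x)[f \o Y t])%E].
Proof.
move=> _ oO connO bO kJ kG kK HAB n1 MP _ gen _ _ mu_ u2 fu x Ex.
have [mA mB AB0 ABE] := HAB n n1.
pose k := jump_kernel (A n) (B n) J G K.
pose mE := measurable_closure Omega.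
pose kappa := law_kernel mE MP.
pose nu := domain_measure oO bO.
have [c JS] := domain_jump_semigroup oO bO kJ kG kK mA mB ABE MP gen.
have kloc := jump_kernel_local kJ kG kK AB0 ABE.
have nupos := domain_measure_gt0 oO bO.
have [C [m [e [mC C0 m0 e0 minor]]]] := doeblin_minorization JS
  (compact_closure_bounded bO) mE (connected_closure connO)
  (domain_measureC oO bO) nupos kloc (ex_intro _ x Ex).
have dx := local_degree_gt0 JS mE nupos kloc Ex.
have [iu u0] := zero_mean_L2_integrable oO bO mu_ u2.
have mu' : measurable_fun setT (u \_ (closure Omega)).
  by apply/(measurable_restrictT _ mE).
have [i1 i2 i3] := potential_formula JS mC C0 m0 e0 minor dx mu' iu u0.
pose L := jump_op nu k (u \_ (closure Omega)).
have fL y : closure Omega y -> f y = L y.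
  move=> Ey; rewrite fu//.
  exact: (neumann_operatorE kJ kG kK mA mB ABE Ey iu).
have fY t : 0 <= t -> f \o Y t = L \o Y t.
  move=> t0; apply/funext => w /=; apply: fL.
  by have [mY _ _ _] := MP; have [_] := mY t t0; apply; exists w.
have kE t (t0 : 0 <= t) := integral_law_kernel Ex t0
  (measurable_int _ (i1 t t0)) (i1 t t0).
have EE t : 0 <= t -> ('E_(P x)[f \o Y t] = \int[kappa t x]_y (L y)%:E)%E.
  by move=> t0; rewrite unlock fY//; have [_ ->] := kE t t0.
split.
- by move=> t t0; rewrite fY//; have [] := kE t t0.
- apply: eq_integrable i2 => // t; rewrite inE/= in_itv/= andbT => t0.
  by rewrite EE.
- have -> : u x = (u \_ (closure Omega)) x by rewrite patchE mem_set.
  rewrite i3; congr (- _)%E; apply: eq_integral => t.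
  by rewrite inE/= in_itv/= andbT => t0; rewrite EE.
Qed.
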